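(* Let $k$ be a field, let $A$ be a coherent $k$-algebra and let $B$ be a finite-dimensional Gorenstein $k$-algebra. Let $X$ be a finitely presented left $A\otimes_k B$-module. Then $X$ is a Gorenstein projective $A\otimes_k B$-module if and only if ${}_A(DB\otimes_B X)$ is a Gorenstein projective left $A$-module and ${}_BX$ is a Gorenstein projective left $B$-module.
   Context: All modules are left modules unless stated otherwise. A $k$-algebra is coherent if it is both left and right coherent as a ring. A finite-dimensional $k$-algebra $B$ is a Gorenstein algebra if the injective dimensions of the left module ${}_BB$ and of the right module $B_B$ are both finite. $D=\mathrm{Hom}_k(-,k)$ denotes the $k$-dual functor; $DB$ is a $B$-$B$-bimodule. For an $A\otimes_k B$-module $X$, ${}_AX$ and ${}_BX$ denote the underlying left $A$-module and left $B$-module of $X$. The tensor product $DB\otimes_B X$ is formed using the right $B$-module structure of $DB$ and ${}_BX$, and ${}_A(DB\otimes_B X)$ is its left $A$-module structure inherited from $X$. For a $k$-algebra $R$, a complex $P^\bullet$ of projective $R$-modules (unbounded in both directions) is totally acyclic if $P^\bullet$ is acyclic and $\mathrm{Hom}_R(P^\bullet,Q)$ is acyclic for each projective $R$-module $Q$. An $R$-module $M$ (not assumed finitely generated) is Gorenstein projective if there is a totally acyclic complex $P^\bullet$ of projective $R$-modules with differentials $d^i:P^i\to P^{i+1}$ such that $M=\mathrm{Ker}\, d^1$. *)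

(* Defs.v *)
From HB Require Import structures.
From mathcomp Require Import all_boot all_algebra all_field.
From mathcomp Require Import boolp.

Set Implicit Arguments.
Unset Strict Implicit.
Unset Printing Implicit Defensive.

Import GRing.Theory.
Local Open Scope ring_scope.
Local Open Scope quotient_scope.

Section Modules.
Variable R : pzRingType.
Implicit Types M N Q U V : lmodType R.

Definition projective Q : Prop :=
  forall M N (g : {linear M -> N}), (forall y, exists x, g x = y) ->
  forall f : {linear Q -> N}, exists h : {linear Q -> M}, forall q, g (h q) = f q.

Definition injective_module Q : Prop :=
  forall U V (i : {linear U -> V}), injective i ->
  forall f : {linear U -> Q}, exists h : {linear V -> Q}, forall u, h (i u) = f u.

Definition finitely_generated M : Prop :=
  exists (n : nat) (p : {linear 'rV[R]_n -> M}), forall y, exists x, p x = y.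

(* exactness of R^m -> R^n -> M -> 0 *)
Definition finitely_presented M : Prop :=
  exists (m n : nat) (q : {linear 'rV[R]_m -> 'rV[R]_n})
         (p : {linear 'rV[R]_n -> M}),
    (forall y, exists x, p x = y) /\
    (forall x, p x = 0 <-> exists w, q w = x).

(* exactness of 0 -> M -> I 0 -> I 1 -> ... with I i = 0 for i > n *)
Definition injdim_le M (n : nat) : Prop :=
  exists (I : nat -> lmodType R) (d : forall i, {linear I i -> I i.+1})
         (e : {linear M -> I 0%N}),
    [/\ forall i, injective_module (I i),
        injective e,
        forall x, d 0%N x = 0 <-> exists m, e m = x,
        forall i (x : I i.+1), d i.+1 x = 0 <-> exists y, d i y = x
      & forall i, (n < i)%N -> forall x : I i, x = 0].

Definition finite_injdim M : Prop := exists n, injdim_le M n.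

Record complex := Complex {
  cobj :> int -> lmodType R;
  cdiff : forall i, {linear cobj i -> cobj (i + 1)};
  cdiffK : forall i x, cdiff (i + 1) (cdiff i x) = 0
}.

Definition acyclic (P : complex) : Prop :=
  forall i (x : P (i + 1)), cdiff P (i + 1) x = 0 -> exists y, cdiff P i y = x.

(* exactness of Hom(P (i+2), Q) -> Hom(P (i+1), Q) -> Hom(P i, Q) for all i *)
Definition hom_acyclic (P : complex) Q : Prop :=
  forall i (f : {linear P (i + 1) -> Q}), (forall x, f (cdiff P i x) = 0) ->
  exists g : {linear P (i + 1 + 1) -> Q}, forall x, g (cdiff P (i + 1) x) = f x.

Definition totally_acyclic (P : complex) : Prop :=
  [/\ forall i, projective (P i),
      acyclic P
    & forall Q, projective Q -> hom_acyclic P Q].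

Definition gorenstein_projective M : Prop :=
  exists2 P : complex, totally_acyclic P &
    exists2 j : {linear M -> P 1}, injective j &
      forall x, cdiff P 1 x = 0 <-> exists m, j m = x.

End Modules.

(* Right R-modules are encoded as left modules over the opposite ring R^c. *)

Definition left_coherent (R : pzRingType) : Prop :=
  forall (I : lmodType R) (j : {linear I -> R^o}), injective j ->
  finitely_generated I -> finitely_presented I.

Definition coherent (R : pzRingType) : Prop :=
  left_coherent R /\ left_coherent R^c.

Definition gorenstein_algebra (k : fieldType) (B : falgType k) : Prop :=
  finite_injdim (B^o : lmodType B) /\ finite_injdim ((B^c)^o : lmodType B^c).

Definition restriction (R S : pzRingType) (f : {rmorphism R -> S})
  (X : lmodType S) : Type := X.

Section Restriction.
Variables (R S : pzRingType) (f : {rmorphism R -> S}) (X : lmodType S).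
Local Notation rX := (restriction f X).

HB.instance Definition _ := GRing.Zmodule.on rX.

Definition restriction_scale (r : R) (x : rX) : rX := f r *: (x : X).

Fact restriction_scaleA a b x :
  restriction_scale a (restriction_scale b x) = restriction_scale (a * b) x.
Proof. by rewrite /restriction_scale scalerA rmorphM. Qed.
Fact restriction_scale1 : left_id 1 restriction_scale.
Proof. by move=> x; rewrite /restriction_scale rmorph1 scale1r. Qed.
Fact restriction_scaleDr : right_distributive restriction_scale +%R.
Proof. by move=> a x y; apply: scalerDr. Qed.
Fact restriction_scaleDl x : {morph restriction_scale^~ x : a b / a + b}.
Proof. by move=> a b; rewrite /restriction_scale rmorphD scalerDl. Qed.

HB.instance Definition _ := GRing.Zmodule_isLmodule.Build R rX
  restriction_scaleA restriction_scale1 restriction_scaleDr restriction_scaleDl.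

End Restriction.

(* M (x)_S N for a right S-module M and a left S-module N: finite formal sums  *)
(* of pairs, modulo the congruence generated by the bilinearity and balancing *)
(* relations.                                                                 *)
Section Tensor.
Variables (S : pzRingType) (M : lmodType S^c) (N : lmodType S).

Inductive tensor_rel : seq (M * N) -> seq (M * N) -> Prop :=
| tensor_refl s : tensor_rel s s
| tensor_sym s t : tensor_rel s t -> tensor_rel t s
| tensor_trans s t u : tensor_rel s t -> tensor_rel t u -> tensor_rel s u
| tensor_cat s s' t t' :
    tensor_rel s s' -> tensor_rel t t' -> tensor_rel (s ++ t) (s' ++ t')
| tensor_catC s t : tensor_rel (s ++ t) (t ++ s)
| tensor_0l n : tensor_rel [:: (0, n)] [::]
| tensor_Dl m m' n : tensor_rel [:: (m + m', n)] [:: (m, n); (m', n)]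
| tensor_Dr m n n' : tensor_rel [:: (m, n + n')] [:: (m, n); (m, n')]
| tensor_bal m (s : S) n :
    tensor_rel [:: ((s : S^c) *: m, n)] [:: (m, s *: n)].

Definition tensor_relb s t := `[< tensor_rel s t >].

Fact tensor_relb_equiv : equiv_class_of tensor_relb.
Proof.
split=> [s|s t|t s u]; first by apply/asboolP; apply: tensor_refl.
  by apply/asboolP/asboolP => /tensor_sym.
by move=> /asboolP st /asboolP tu; apply/asboolP; apply: tensor_trans tu.
Qed.

Canonical tensor_relb_equivRel := EquivRelPack tensor_relb_equiv.

Definition tensor : Type := {eq_quot tensor_relb}.
HB.instance Definition _ : EqQuotient _ tensor_relb tensor :=
  EqQuotient.on tensor.
HB.instance Definition _ := Choice.on tensor.

Lemma tensor_eqP s t :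
  reflect (tensor_rel s t) (\pi_tensor s == \pi_tensor t).
Proof.
by rewrite eqmodE; apply: asboolP.
Qed.

Lemma tensor_pi s t : tensor_rel s t -> \pi_tensor s = \pi_tensor t.
Proof. by move/tensor_eqP/eqP. Qed.

Lemma tensor_reprP s : tensor_rel (repr (\pi_tensor s)) s.
Proof. by apply/tensor_eqP; rewrite reprK. Qed.

Definition tensor_opps (s : seq (M * N)) := [seq (- p.1, p.2) | p <- s].

Definition tensor_zero : tensor := \pi_tensor [::].
Definition tensor_add (x y : tensor) : tensor := \pi_tensor (repr x ++ repr y).
Definition tensor_opp (x : tensor) : tensor := \pi_tensor (tensor_opps (repr x)).

Lemma tensor_add_pi s t :
  tensor_add (\pi_tensor s) (\pi_tensor t) = \pi_tensor (s ++ t).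
Proof. by apply: tensor_pi; apply: tensor_cat; apply: tensor_reprP. Qed.

Fact tensor_addA : associative tensor_add.
Proof.
elim/quotW => s; elim/quotW => t; elim/quotW => u.
by rewrite (tensor_add_pi t u) (tensor_add_pi s t) !tensor_add_pi catA.
Qed.
Fact tensor_addC : commutative tensor_add.
Proof.
elim/quotW => s; elim/quotW => t; rewrite (tensor_add_pi s t) (tensor_add_pi t s).
exact/tensor_pi/tensor_catC.
Qed.
Fact tensor_add0 : left_id tensor_zero tensor_add.
Proof. by elim/quotW => s; rewrite (tensor_add_pi [::] s). Qed.
Fact tensor_addN : left_inverse tensor_zero tensor_opp tensor_add.
Proof.
move=> x; rewrite -[in X in tensor_add _ X](reprK x) (tensor_add_pi _ (repr x)).
apply: tensor_pi; elim: (repr x) => [|[m n] s IHs]; first exact: tensor_refl.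
apply: (tensor_trans _ IHs); rewrite /= -[(m, n) :: s]cat1s.
set o := tensor_opps s; pose a := [:: (- m, n)]; pose b := [:: (m, n)].
apply: (@tensor_trans _ (a ++ ((b ++ s) ++ o))).
  by apply: (@tensor_cat a a (o ++ (b ++ s))); [apply: tensor_refl|apply: tensor_catC].
apply: tensor_trans (tensor_catC s o).
apply: (@tensor_cat (a ++ b) [::] (s ++ o) (s ++ o)); last exact: tensor_refl.
by apply: tensor_trans (tensor_0l n); rewrite -(addNr m); apply/tensor_sym/tensor_Dl.
Qed.

HB.instance Definition _ := GRing.isZmodule.Build tensor
  tensor_addA tensor_addC tensor_add0 tensor_addN.

Definition tens (m : M) (n : N) : tensor := \pi_tensor [:: (m, n)].

Lemma pi_tensorE s : \pi_tensor s = \sum_(p <- s) tens p.1 p.2.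
Proof.
elim: s => [|p s IHs]; rewrite ?(big_nil, big_cons) // -IHs.
by rewrite -[LHS](tensor_add_pi [:: p]); case: p.
Qed.

Lemma tensorE x : x = \sum_(p <- repr x) tens p.1 p.2.
Proof. by rewrite -pi_tensorE reprK. Qed.

Lemma tensDl m m' n : tens (m + m') n = tens m n + tens m' n.
Proof.
by rewrite [LHS](tensor_pi (tensor_Dl m m' n)) pi_tensorE !big_cons big_nil addr0.
Qed.

Lemma tensDr m n n' : tens m (n + n') = tens m n + tens m n'.
Proof.
by rewrite [LHS](tensor_pi (tensor_Dr m n n')) pi_tensorE !big_cons big_nil addr0.
Qed.

Lemma tens_bal m (s : S) n : tens ((s : S^c) *: m) n = tens m (s *: n).
Proof. exact/tensor_pi/tensor_bal. Qed.

Lemma tensor_ind (P : tensor -> Prop) :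
  P 0 -> (forall m n x, P x -> P (tens m n + x)) -> forall x, P x.
Proof.
move=> P0 PD x; rewrite (tensorE x).
by elim: (repr x) => [|p s IHs]; rewrite ?(big_nil, big_cons) //; apply: PD.
Qed.

Definition balanced (V : zmodType) (f : M -> N -> V) : Prop :=
  [/\ forall m m' n, f (m + m') n = f m n + f m' n,
      forall m n n', f m (n + n') = f m n + f m n'
    & forall m (s : S) n, f ((s : S^c) *: m) n = f m (s *: n)].

Definition tlift (V : zmodType) (f : M -> N -> V) (x : tensor) : V :=
  \sum_(p <- repr x) f p.1 p.2.

Section Lift.
Variables (V : zmodType) (f : M -> N -> V) (fP : balanced f).

Lemma tlift_rel s t : tensor_rel s t ->
  \sum_(p <- s) f p.1 p.2 = \sum_(p <- t) f p.1 p.2.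
Proof.
have [fDl fDr fB] := fP.
elim=> {s t} [//|//|s t u _ -> _ ->//|s s' t t' _ IHs _ IHt|s t|n|m m' n|m n n'|m s n].
- by rewrite !big_cat IHs IHt.
- by rewrite !big_cat /= addrC.
- rewrite big_cons big_nil addr0 /=.
  by apply: (addrI (f 0 n)); rewrite -fDl !addr0.
- by rewrite !(big_cons, big_nil) addr0 fDl addr0.
- by rewrite !(big_cons, big_nil) addr0 fDr addr0.
by rewrite !(big_cons, big_nil) /= fB.
Qed.

Lemma tlift_pi s : tlift f (\pi_tensor s) = \sum_(p <- s) f p.1 p.2.
Proof. exact/tlift_rel/tensor_reprP. Qed.

Lemma tlift0 : tlift f 0 = 0.
Proof. by rewrite [tlift f 0]tlift_pi big_nil. Qed.

Lemma tliftE m n : tlift f (tens m n) = f m n.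
Proof. by rewrite tlift_pi big_cons big_nil addr0. Qed.

Lemma tliftD x y : tlift f (x + y) = tlift f x + tlift f y.
Proof.
by elim/quotW: x => s; elim/quotW: y => t; rewrite [_ + _]tensor_add_pi !tlift_pi big_cat /=.
Qed.

End Lift.

Lemma eq_tlift (V : zmodType) (f g : M -> N -> V) x :
  (forall m n, f m n = g m n) -> tlift f x = tlift g x.
Proof. by move=> fg; apply: eq_bigr => p _. Qed.

Lemma tlift_add (V : zmodType) (f g : M -> N -> V) x :
  tlift (fun m n => f m n + g m n) x = tlift f x + tlift g x.
Proof. exact: big_split. Qed.

End Tensor.

(* A module over a commutative ring, viewed as a right module. *)
Definition right_mod (k : comPzRingType) (V : lmodType k) : Type := V.

Section RightMod.
Variables (k : comPzRingType) (V : lmodType k).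

HB.instance Definition _ := GRing.Zmodule.on (right_mod V).

Definition right_mod_scale (c : k^c) (v : right_mod V) : right_mod V :=
  (c : k) *: (v : V).

Fact right_mod_scaleA a b v :
  right_mod_scale a (right_mod_scale b v) = right_mod_scale (a * b) v.
Proof. by rewrite /right_mod_scale scalerA mulrC. Qed.
Fact right_mod_scale1 : left_id 1 right_mod_scale.
Proof. by move=> v; apply: scale1r. Qed.
Fact right_mod_scaleDr : right_distributive right_mod_scale +%R.
Proof. by move=> a x y; apply: scalerDr. Qed.
Fact right_mod_scaleDl v : {morph right_mod_scale^~ v : a b / a + b}.
Proof. by move=> a b; apply: scalerDl. Qed.

HB.instance Definition _ := GRing.Zmodule_isLmodule.Build k^c (right_mod V)
  right_mod_scaleA right_mod_scale1 right_mod_scaleDr right_mod_scaleDl.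

End RightMod.

Section TensorAlgebra.
Variables (k : fieldType) (A : algType k) (B : falgType k).

Definition tensor_alg : Type := tensor (right_mod A : lmodType k^c) (B : lmodType k).
HB.instance Definition _ := GRing.Zmodule.on tensor_alg.

Definition ptens (a : A) (b : B) : tensor_alg := tens (a : right_mod A) b.

Lemma ptensDl a a' b : ptens (a + a') b = ptens a b + ptens a' b.
Proof. exact: tensDl. Qed.
Lemma ptensDr a b b' : ptens a (b + b') = ptens a b + ptens a b'.
Proof. exact: tensDr. Qed.
Lemma ptensZ (c : k) a b : ptens (c *: a) b = ptens a (c *: b).
Proof. exact: (tens_bal (a : right_mod A) c b). Qed.

Lemma tensor_alg_ind (P : tensor_alg -> Prop) :
  P 0 -> (forall a b x, P x -> P (ptens a b + x)) -> forall x, P x.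
Proof. by move=> P0 PD x; apply: (@tensor_ind _ _ _ P). Qed.

Definition tensor_mul1 (a : A) (b : B) (y : tensor_alg) : tensor_alg :=
  tlift (fun (a' : right_mod A) b' => ptens (a * (a' : A)) (b * b')) y.

(* (a (x) b) (a' (x) b') = a a' (x) b b' *)
Definition tensor_mul (x y : tensor_alg) : tensor_alg :=
  tlift (fun (a : right_mod A) b => tensor_mul1 a b y) x.

Definition tensor_scale (c : k) (x : tensor_alg) : tensor_alg :=
  tlift (fun (a : right_mod A) b => ptens (c *: (a : A)) b) x.

Fact tensor_mul1_balanced (a : A) (b : B) :
  balanced (fun (a' : right_mod A) b' => ptens (a * (a' : A)) (b * b')).
Proof.
split=> [m m' n|m n n'|m c n]; first by rewrite mulrDr ptensDl.
  by rewrite mulrDr ptensDr.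
by rewrite -(scalerAr c b n) -ptensZ scalerAr.
Qed.

Fact tensor_mul_balanced y :
  balanced (fun (a : right_mod A) b => tensor_mul1 a b y).
Proof.
split=> [m m' n|m n n'|m c n]; rewrite /tensor_mul1 -?tlift_add.
- by apply: eq_tlift => a b; rewrite mulrDl ptensDl.
- by apply: eq_tlift => a b; rewrite mulrDl ptensDr.
- by apply: eq_tlift => a b; rewrite -(scalerAl c n b) -ptensZ scalerAl.
Qed.

Fact tensor_scale_balanced c :
  balanced (fun (a : right_mod A) b => ptens (c *: (a : A)) b).
Proof.
split=> [m m' n|m n n'|m d n]; first by rewrite scalerDr ptensDl.
  by rewrite ptensDr.
by rewrite -ptensZ scalerA mulrC -scalerA.
Qed.

Lemma tensor_mulE a b a' b' :
  tensor_mul (ptens a b) (ptens a' b') = ptens (a * a') (b * b').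
Proof.
rewrite /tensor_mul tliftE; last exact: tensor_mul_balanced.
by rewrite /tensor_mul1 tliftE //; apply: tensor_mul1_balanced.
Qed.

Lemma tensor_scaleE c a b : tensor_scale c (ptens a b) = ptens (c *: a) b.
Proof. by rewrite /tensor_scale tliftE //; apply: tensor_scale_balanced. Qed.

Fact tensor_mulDl : left_distributive tensor_mul +%R.
Proof. by move=> x y z; apply/tliftD/tensor_mul_balanced. Qed.
Fact tensor_mulDr : right_distributive tensor_mul +%R.
Proof.
move=> x y z; rewrite /tensor_mul -tlift_add; apply: eq_tlift => a b.
exact/tliftD/tensor_mul1_balanced.
Qed.
Fact tensor_mul0l x : tensor_mul 0 x = 0.
Proof. exact/tlift0/tensor_mul_balanced. Qed.
Fact tensor_mul0r x : tensor_mul x 0 = 0.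
Proof. by apply: (addrI (tensor_mul x 0)); rewrite -tensor_mulDr !addr0. Qed.

Fact tensor_mulA : associative tensor_mul.
Proof.
move=> x y z; elim/tensor_alg_ind: x => [|a b x IHx]; first by rewrite !tensor_mul0l.
rewrite !tensor_mulDl IHx; congr (_ + _) => {x IHx}.
elim/tensor_alg_ind: y => [|a' b' y IHy].
  by rewrite tensor_mul0r !tensor_mul0l tensor_mul0r.
rewrite !(tensor_mulDl, tensor_mulDr) IHy; congr (_ + _) => {y IHy}.
elim/tensor_alg_ind: z => [|a2 b2 z IHz]; first by rewrite !tensor_mul0r.
by rewrite !tensor_mulDr IHz !tensor_mulE !mulrA.
Qed.

Fact tensor_mul1l : left_id (ptens 1 1) tensor_mul.
Proof.
elim/tensor_alg_ind => [|a b x IHx]; first exact: tensor_mul0r.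
by rewrite tensor_mulDr IHx tensor_mulE !mul1r.
Qed.
Fact tensor_mul1r : right_id (ptens 1 1) tensor_mul.
Proof.
elim/tensor_alg_ind => [|a b x IHx]; first exact: tensor_mul0l.
by rewrite tensor_mulDl IHx tensor_mulE !mulr1.
Qed.

Fact tensor_one_neq0 : ptens 1 1 != 0.
Proof.
have [i i1] : exists i, coord (vbasis {:B}) i 1 != 0.
  apply/existsP; apply: contraNT (oner_neq0 B) => /existsPn c0.
  rewrite (coord_vbasis (memvf 1)) big1 // => i _.
  by have /negPn/eqP -> := c0 i; rewrite scale0r.
pose f (a : right_mod A) (b : B) : A := coord (vbasis {:B}) i b *: (a : A).
have fP : balanced f.
  split=> [m m' n|m n n'|m c n]; rewrite /f; first exact: scalerDr.
    by rewrite linearD scalerDl.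
  have -> : coord (vbasis {:B}) i (c *: n) = c * coord (vbasis {:B}) i n.
    exact: linearZ.
  by rewrite mulrC -scalerA.
apply/eqP => /(congr1 (tlift f)); rewrite tlift0 // tliftE // => /eqP.
by rewrite scaler_eq0 (negPf i1) oner_eq0.
Qed.

HB.instance Definition _ := GRing.Zmodule_isNzRing.Build tensor_alg
  tensor_mulA tensor_mul1l tensor_mul1r tensor_mulDl tensor_mulDr
  tensor_one_neq0.

Lemma ptensM a b a' b' : ptens a b * ptens a' b' = ptens (a * a') (b * b').
Proof. exact: tensor_mulE. Qed.

Fact tensor_scaleDr : right_distributive tensor_scale +%R.
Proof. by move=> c x y; apply/tliftD/tensor_scale_balanced. Qed.
Fact tensor_scale0r c : tensor_scale c 0 = 0.
Proof. exact/tlift0/tensor_scale_balanced. Qed.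
Fact tensor_scaleA c d x :
  tensor_scale c (tensor_scale d x) = tensor_scale (c * d) x.
Proof.
elim/tensor_alg_ind: x => [|a b x IHx]; first by rewrite !tensor_scale0r.
by rewrite !tensor_scaleDr IHx !tensor_scaleE scalerA.
Qed.
Fact tensor_scale1 : left_id 1 tensor_scale.
Proof.
elim/tensor_alg_ind => [|a b x IHx]; first exact: tensor_scale0r.
by rewrite tensor_scaleDr IHx tensor_scaleE scale1r.
Qed.
Fact tensor_scaleDl x : {morph tensor_scale^~ x : c d / c + d}.
Proof.
move=> c d; rewrite /tensor_scale -tlift_add; apply: eq_tlift => a b.
by rewrite scalerDl ptensDl.
Qed.

HB.instance Definition _ := GRing.Zmodule_isLmodule.Build k tensor_alg
  tensor_scaleA tensor_scale1 tensor_scaleDr tensor_scaleDl.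

Lemma ptensZl c a b : c *: ptens a b = ptens (c *: a) b.
Proof. exact: tensor_scaleE. Qed.

Fact tensor_scaleAl c (x y : tensor_alg) : c *: (x * y) = c *: x * y.
Proof.
elim/tensor_alg_ind: x => [|a b x IHx]; first by rewrite !(mul0r, scaler0).
rewrite !(mulrDl, scalerDr) IHx; congr (_ + _) => {x IHx}.
elim/tensor_alg_ind: y => [|a' b' y IHy]; first by rewrite !(mulr0, scaler0).
by rewrite !(mulrDr, scalerDr) IHy !(ptensM, ptensZl) scalerAl.
Qed.
HB.instance Definition _ := GRing.Lmodule_isLalgebra.Build k tensor_alg
  tensor_scaleAl.

Fact tensor_scaleAr c (x y : tensor_alg) : c *: (x * y) = x * (c *: y).
Proof.
elim/tensor_alg_ind: x => [|a b x IHx]; first by rewrite !(mul0r, scaler0).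
rewrite !(mulrDl, scalerDr) IHx; congr (_ + _) => {x IHx}.
elim/tensor_alg_ind: y => [|a' b' y IHy]; first by rewrite !(mulr0, scaler0).
by rewrite !(mulrDr, scalerDr) IHy !(ptensM, ptensZl) scalerAr.
Qed.
HB.instance Definition _ := GRing.Lalgebra_isAlgebra.Build k tensor_alg
  tensor_scaleAr.

Definition tensor_inl (a : A) : tensor_alg := ptens a 1.
Definition tensor_inr (b : B) : tensor_alg := ptens 1 b.

Fact tensor_inl_zmod_morphism : zmod_morphism tensor_inl.
Proof.
by move=> a a'; apply: (addIr (tensor_inl a')); rewrite subrK -ptensDl subrK.
Qed.
HB.instance Definition _ := GRing.isZmodMorphism.Build A tensor_alg tensor_inl
  tensor_inl_zmod_morphism.
Fact tensor_inl_monoid_morphism : monoid_morphism tensor_inl.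
Proof. by split=> // a a'; rewrite ptensM mulr1. Qed.
HB.instance Definition _ := GRing.isMonoidMorphism.Build A tensor_alg tensor_inl
  tensor_inl_monoid_morphism.

Fact tensor_inr_zmod_morphism : zmod_morphism tensor_inr.
Proof.
by move=> b b'; apply: (addIr (tensor_inr b')); rewrite subrK -ptensDr subrK.
Qed.
HB.instance Definition _ := GRing.isZmodMorphism.Build B tensor_alg tensor_inr
  tensor_inr_zmod_morphism.
Fact tensor_inr_monoid_morphism : monoid_morphism tensor_inr.
Proof. by split=> // b b'; rewrite ptensM mulr1. Qed.
HB.instance Definition _ := GRing.isMonoidMorphism.Build B tensor_alg tensor_inr
  tensor_inr_monoid_morphism.

Lemma tensor_inlr a b : tensor_inl a * tensor_inr b = ptens a b.
Proof. by rewrite ptensM mulr1 mul1r. Qed.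
Lemma tensor_inrl a b : tensor_inr b * tensor_inl a = ptens a b.
Proof. by rewrite ptensM mulr1 mul1r. Qed.

End TensorAlgebra.

(* DB = Hom_k(B, k) as a right B-module: (f b)(x) = f (b x). *)
Definition dual (k : fieldType) (B : falgType k) : Type := 'Hom(B, k^o).

Section Dual.
Variables (k : fieldType) (B : falgType k).

HB.instance Definition _ := GRing.Zmodule.on (dual B).

Definition dual_scale (b : B^c) (f : dual B) : dual B :=
  ((f : 'Hom(B, k^o)) \o amull (b : B))%VF.

Lemma dual_scaleE b f x :
  (dual_scale b f : 'Hom(B, k^o)) x = (f : 'Hom(B, k^o)) ((b : B) * x).
Proof. by rewrite lfunE /= lfunE. Qed.

Fact dual_scaleA a b f : dual_scale a (dual_scale b f) = dual_scale (a * b) f.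
Proof. by apply/lfunP => x; rewrite !dual_scaleE mulrA. Qed.
Fact dual_scale1 : left_id 1 dual_scale.
Proof. by move=> f; apply/lfunP => x; rewrite dual_scaleE mul1r. Qed.
Fact dual_scaleDr : right_distributive dual_scale +%R.
Proof.
move=> b f g; apply/lfunP => x; rewrite dual_scaleE.
by rewrite [LHS]add_lfunE [RHS]add_lfunE !dual_scaleE.
Qed.
Fact dual_scaleDl f : {morph dual_scale^~ f : a b / a + b}.
Proof.
move=> a b; apply/lfunP => x; rewrite [RHS]add_lfunE !dual_scaleE.
by rewrite -linearD -mulrDl.
Qed.

HB.instance Definition _ := GRing.Zmodule_isLmodule.Build B^c (dual B)
  dual_scaleA dual_scale1 dual_scaleDr dual_scaleDl.

End Dual.

Section DualTensor.
Variables (k : fieldType) (A : algType k) (B : falgType k).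
Variable X : lmodType (tensor_alg A B).

Definition restrict_l : lmodType A := restriction (@tensor_inl k A B) X.
Definition restrict_r : lmodType B := restriction (@tensor_inr k A B) X.

Definition dual_tensor : Type := tensor (dual B : lmodType B^c) restrict_r.
HB.instance Definition _ := GRing.Zmodule.on dual_tensor.

(* a (f (x) x) = f (x) a x *)
Definition dual_tensor_scale (a : A) (t : dual_tensor) : dual_tensor :=
  tlift (fun (f : dual B) (x : restrict_r) =>
           tens f (tensor_inl B a *: (x : X) : restrict_r)) t.

Fact dual_tensor_scale_balanced (a : A) :
  balanced (fun (f : dual B) (x : restrict_r) =>
           tens f (tensor_inl B a *: (x : X) : restrict_r)).
Proof.
split=> [f f' x|f x x'|f b x]; first exact: tensDl.
  by rewrite scalerDr tensDr.
rewrite tens_bal; congr tens.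
by rewrite [LHS]scalerA [RHS]scalerA tensor_inlr tensor_inrl.
Qed.

Lemma dual_tensor_scaleE a (f : dual B) (x : restrict_r) :
  dual_tensor_scale a (tens f x) = tens f (tensor_inl B a *: (x : X) : restrict_r).
Proof.
by rewrite /dual_tensor_scale tliftE //; apply: dual_tensor_scale_balanced.
Qed.

Fact dual_tensor_scaleDr : right_distributive dual_tensor_scale +%R.
Proof. by move=> c x y; apply/tliftD/dual_tensor_scale_balanced. Qed.
Fact dual_tensor_scale0r c : dual_tensor_scale c 0 = 0.
Proof. exact/tlift0/dual_tensor_scale_balanced. Qed.
Fact dual_tensor_scaleA a b t :
  dual_tensor_scale a (dual_tensor_scale b t) = dual_tensor_scale (a * b) t.
Proof.
elim/tensor_ind: t => [|f x t IHt]; first by rewrite !dual_tensor_scale0r.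
by rewrite !dual_tensor_scaleDr IHt !dual_tensor_scaleE scalerA rmorphM.
Qed.
Fact dual_tensor_scale1 : left_id 1 dual_tensor_scale.
Proof.
elim/tensor_ind => [|f x t IHt]; first exact: dual_tensor_scale0r.
by rewrite dual_tensor_scaleDr IHt dual_tensor_scaleE rmorph1 scale1r.
Qed.
Fact dual_tensor_scaleDl t : {morph dual_tensor_scale^~ t : a b / a + b}.
Proof.
move=> a b; rewrite /dual_tensor_scale -tlift_add; apply: eq_tlift => f x.
by rewrite rmorphD scalerDl tensDr.
Qed.

HB.instance Definition _ := GRing.Zmodule_isLmodule.Build A dual_tensor
  dual_tensor_scaleA dual_tensor_scale1 dual_tensor_scaleDr dual_tensor_scaleDl.

End DualTensor.

(* Main.v *)
(* F = DB (x)_B - from A (x) B-modules to A-modules has the exact right adjoint *)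
(* G = Hom_k(DB, -), isomorphic to B (x)_k -, so F and G preserve projectives, *)
(* and every projective A (x) B-module P is a retract of GFP.  Hence maps from *)
(* X to projectives extend along i : X -> Y as soon as maps from FX to         *)
(* projective A-modules extend along Fi.  The same adjunction for k instead of *)
(* A shows that maps of B-modules to projectives extend along i exactly when   *)
(* DB (x)_B i is injective.                                                    *)
(*                                                                            *)
(* A module is Gorenstein projective iff it belongs to a class of modules      *)
(* closed under syzygies and under cokernels of embeddings i : X -> P with P   *)
(* projective, such that all these short exact sequences stay exact under      *)
(* Hom(-, projective).                                                         *)
(*                                                                            *)
(* If X is Gorenstein projective, let K be any syzygy or cosyzygy in its       *)
(* totally acyclic complex.  Finite injective dimension of B gives             *)
(* Ext^1_B(K, B) = 0, i.e. DB (x)_B - keeps the complex exact, and the two     *)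
(* adjunctions transport the Hom-exactness.  Conversely, the X with FX and X|B *)
(* Gorenstein projective form a class as above: compose the unit X -> GFX with *)
(* G of an embedding FX -> Q into a projective to get a cosyzygy, and note     *)
(* that cokernels and kernels of such maps inherit Gorenstein projectivity by  *)
(* Schanuel's lemma.                                                           *)

Require Import Defs.
From HB Require Import structures.
From mathcomp Require Import all_boot all_algebra all_field.
From mathcomp Require Import boolp classical_sets.
From mathcomp.multinomials Require freeg.

Set Implicit Arguments.
Unset Strict Implicit.
Unset Printing Implicit Defensive.

Import GRing.Theory.
Local Open Scope ring_scope.
Local Open Scope quotient_scope.

(** * Kernels and cokernels *)

(** Let F be [dual_tensor] and G be [coindA], so that G Q is Hom_k(DB, Q), which is also B tensored
    with Q over k. G is therefore an adjoint on two sides: right adjoint to F ([dual_tensor_adj],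
    [dual_tensor_coadj]) and left adjoint to restriction to A ([coindA_lift]). Both F and G preserve
    projectives, and the unit X -> GFX splits for projective X ([projective_coindA_dual_tensor]).
    Hence extending maps to projectives along i and along Fi are equivalent problems
    ([dual_tensor_extends], [extends_dual_tensor]). With [k] in place of [A], all modules are
    injective and extension along a B-map just means that DB tensored with it is injective
    ([tmap_inj_extends], [extends_tmap_inj]).

    Forward: dimension shifting along an injective resolution of B ([finite_injdim_extends]) shows
    that all syzygies in a totally acyclic complex stay exact under F, so F and restriction to B
    carry the complex to totally acyclic ones.

    Backward: by [gp_coind] it suffices that the pairs condition [gp_pair] is stable under one step
    to the right and one to the left. Modules of the form G Q with Q projective provide the middle
    terms, and [gp_cokernel] and [gp_kernel] keep the outer terms Gorenstein projective. These two
    rest on Schanuel's lemma and on cancellation of projective summands, [gp_stable]. *)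

Section LinearMaps.
Variable R : pzRingType.
Implicit Types M N P Q : lmodType R.

Lemma linear_fun M N (f : M -> N) : linear f ->
  exists h : {linear M -> N}, forall x, h x = f x.
Proof.
move=> flin.
pose h : {linear M -> N} := HB.pack f (GRing.isLinear.Build R M N *:%R f flin).
by exists h.
Qed.

Lemma factor_surj M N Q (p : {linear M -> N}) (f : {linear M -> Q}) :
  (forall y, exists x, p x = y) -> (forall x, p x = 0 -> f x = 0) ->
  exists g : {linear N -> Q}, forall x, g (p x) = f x.
Proof.
move=> /choice[s ps] pf.
have fsp x : f (s (p x)) = f x.
  by apply/eqP; rewrite -subr_eq0 -linearB; apply/eqP/pf; rewrite linearB /= ps subrr.
have [|g gE] := @linear_fun N Q (fun y => f (s y)); last first.
  by exists g => x; rewrite gE.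
by move=> a y z; rewrite -{1}(ps y) -{1}(ps z) -linearP fsp linearP.
Qed.

Lemma factor_inj M N Q (j : {linear M -> N}) (f : {linear Q -> N}) :
  injective j -> (forall x, exists m, j m = f x) ->
  exists g : {linear Q -> M}, forall x, j (g x) = f x.
Proof.
move=> j_inj /choice[s js].
have [|g gE] := @linear_fun Q M s; last by exists g => x; rewrite gE.
by move=> a x y; apply: j_inj; rewrite linearP !js linearP.
Qed.

End LinearMaps.

Section Kernel.
Variables (R : pzRingType) (M N : lmodType R) (f : {linear M -> N}).

Definition kernel_pred : {pred M} := fun x => f x == 0.

Fact kernel_pred_submod : submod_closed kernel_pred.
Proof.
split=> [|a x y]; rewrite !unfold_in ?linear0 //.
by move=> /eqP fx /eqP fy; rewrite linearP fx fy scaler0 addr0.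
Qed.

HB.instance Definition _ :=
  GRing.isSubmodClosed.Build R M kernel_pred kernel_pred_submod.

Record kernel := Kernel { kernel_val :> M; _ : kernel_val \in kernel_pred }.

HB.instance Definition _ := [isSub for kernel_val].
HB.instance Definition _ := [Choice of kernel by <:].
HB.instance Definition _ := [SubChoice_isSubLmodule of kernel by <:].

Lemma kernel_incl : exists j : {linear kernel -> M},
  injective j /\ forall x, f x = 0 <-> exists m, j m = x.
Proof.
exists (\val : {linear kernel -> M}); split=> [|x]; first exact: val_inj.
split=> [/eqP fx|[[m mP] <-]]; first by exists (Kernel fx).
exact/eqP.
Qed.

End Kernel.

Section Cokernel.
Variables (R : pzRingType) (M N : lmodType R) (f : {linear M -> N}).

Definition range_pred : {pred N} := fun y => `[< exists x, f x = y >].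

Fact range_pred_zmod : zmod_closed range_pred.
Proof.
split=> [|x y]; first by apply/asboolP; exists 0; rewrite linear0.
move=> /asboolP[u <-] /asboolP[v <-]; apply/asboolP.
by exists (u - v); rewrite linearB.
Qed.

HB.instance Definition _ := GRing.isZmodClosed.Build N range_pred range_pred_zmod.

Definition coker := Quotient.quot range_pred.
HB.instance Definition _ := GRing.Zmodule.on coker.

Definition coker_proj (x : N) : coker := \pi_coker x.

Lemma coker_proj_surj (y : coker) : exists x, coker_proj x = y.
Proof. by exists (repr y); rewrite /coker_proj reprK. Qed.

Lemma coker_proj_eq x y : coker_proj x = coker_proj y <-> exists m, f m = x - y.
Proof.
rewrite /coker_proj; split.
  by move=> /eqP; rewrite -Quotient.idealrBE => /asboolP.
by move=> xy; apply/eqP; rewrite -Quotient.idealrBE; apply/asboolP.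
Qed.

Lemma coker_projD x y : coker_proj (x + y) = coker_proj x + coker_proj y.
Proof. by rewrite /coker_proj !piE. Qed.

Definition coker_scale (a : R) (y : coker) : coker := coker_proj (a *: repr y).

Lemma coker_scaleE a x : coker_scale a (coker_proj x) = coker_proj (a *: x).
Proof.
have [m fm] : exists m, f m = repr (coker_proj x) - x.
  by apply/coker_proj_eq; rewrite /coker_proj reprK.
by apply/coker_proj_eq; exists (a *: m); rewrite linearZ /= fm scalerBr.
Qed.

Fact coker_scaleA a b y : coker_scale a (coker_scale b y) = coker_scale (a * b) y.
Proof. by have [x <-] := coker_proj_surj y; rewrite !coker_scaleE scalerA. Qed.
Fact coker_scale1 : left_id 1 coker_scale.
Proof. by move=> y; have [x <-] := coker_proj_surj y; rewrite coker_scaleE scale1r. Qed.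
Fact coker_scaleDr : right_distributive coker_scale +%R.
Proof.
move=> a y z; have [x <-] := coker_proj_surj y; have [x' <-] := coker_proj_surj z.
by rewrite -coker_projD !coker_scaleE scalerDr coker_projD.
Qed.
Fact coker_scaleDl y : {morph coker_scale^~ y : a b / a + b}.
Proof.
move=> a b; have [x <-] := coker_proj_surj y.
by rewrite !coker_scaleE scalerDl coker_projD.
Qed.

HB.instance Definition _ := GRing.Zmodule_isLmodule.Build R coker
  coker_scaleA coker_scale1 coker_scaleDr coker_scaleDl.

Lemma cokernel_proj : exists p : {linear N -> coker},
  (forall y, exists x, p x = y) /\ (forall x, p x = 0 <-> exists m, f m = x).
Proof.
have [|p pE] := @linear_fun R N coker coker_proj.
  by move=> a x y; rewrite coker_projD -coker_scaleE.
exists p; split=> [y|x].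
  by have [x <-] := coker_proj_surj y; exists x; rewrite pE.
rewrite -(linear0 p) !pE; rewrite -[X in exists m, _ = X]subr0.
exact: coker_proj_eq.
Qed.

End Cokernel.

(** * Gorenstein projective modules *)

Section GorensteinProjective.
Variable R : pzRingType.
Implicit Types M N P Q : lmodType R.

Definition short_exact M P N (j : {linear M -> P}) (p : {linear P -> N}) :=
  [/\ injective j, forall y, exists x, p x = y
    & forall x, p x = 0 <-> exists m, j m = x].

Definition proj_extends M P (j : {linear M -> P}) :=
  forall Q, projective Q -> forall f : {linear M -> Q},
  exists g : {linear P -> Q}, forall m, g (j m) = f m.

(* N is the cokernel of a left Proj(R)-approximation of M by a projective P *)
Definition cosyzygy M N :=
  exists P (j : {linear M -> P}) (p : {linear P -> N}),
    [/\ projective P, short_exact j p & proj_extends j].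

Definition isomorphic M N := exists f : {linear M -> N},
  injective f /\ forall y, exists x, f x = y.

Lemma iso_sym M N : isomorphic M N -> isomorphic N M.
Proof.
move=> [f [finj fsurj]].
have [y|g gE] := @factor_inj _ _ _ _ f (idfun : {linear N -> N}) finj.
  exact: fsurj.
exists g; split=> [x y /(congr1 f)|m]; first by rewrite !gE.
by exists (f m); apply: finj; rewrite gE.
Qed.

Lemma iso_cancel M N (f : {linear M -> N}) (g : {linear N -> M}) :
  cancel f g -> cancel g f -> isomorphic M N.
Proof. by move=> fK gK; exists f; split=> [|y]; [apply: can_inj fK|exists (g y)]. Qed.

Lemma gp_iso M N : isomorphic M N -> gorenstein_projective N -> gorenstein_projective M.
Proof.
move=> [f [finj fsurj]] [P totP [j jinj jE]].
exists P => //; exists (j \o f); first exact: inj_comp.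
move=> x; rewrite jE; split=> [[m <-]|[m <-]]; last by exists (f m).
by have [m' <-] := fsurj m; exists m'.
Qed.

(** Splice the short exact sequences. A map on the term [P (i + 1)] that kills the previous
    differential factors through [M (i + 1 + 1)], and then extends along the next embedding. *)
Lemma gp_of_cosyzygies (M : int -> lmodType R) :
  (forall i, cosyzygy (M i) (M (i + 1))) -> gorenstein_projective (M 1).
Proof.
move=> H.
have {}H i : {P : lmodType R & {j : {linear M i -> P} &
    {p : {linear P -> M (i + 1)} | [/\ projective P, short_exact j p & proj_extends j]}}}.
  have [P /cid[j /cid[p ?]]] := cid (H i).
  by exists P, j, p.
pose P i := projT1 (H i).
pose j i : {linear M i -> P i} := projT1 (projT2 (H i)).
pose p i : {linear P i -> M (i + 1)} := sval (projT2 (projT2 (H i))).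
have Pproj i : projective (P i) by have [] := svalP (projT2 (projT2 (H i))).
have jpE i : short_exact (j i) (p i) by have [] := svalP (projT2 (projT2 (H i))).
have jext i : proj_extends (j i) by have [] := svalP (projT2 (projT2 (H i))).
pose d i : {linear P i -> P (i + 1)} := j (i + 1) \o p i.
have dK i x : d (i + 1) (d i x) = 0.
  have [_ _ pj] := jpE (i + 1).
  by rewrite /= (_ : p (i + 1) _ = 0) ?linear0 //; apply/pj; exists (p i x).
have dE i x : d i x = 0 <-> exists m, j i m = x.
  have [_ _ pj] := jpE i; have [jinj _ _] := jpE (i + 1).
  by rewrite -pj /=; split=> [/eqP|->]; rewrite ?linear0 // raddf_eq0 // => /eqP.
exists (Complex dK); last by exists (j 1); [have [] := jpE 1|exact: dE].
split=> [//|i x /= /dE[m <-]|Q Qproj i f fd].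
  by have [_ /(_ m)[y <-] _] := jpE i; exists y.
have [_ psurj pj] := jpE (i + 1); have [_ pisurj _] := jpE i.
have [x /pj[m <-]|f' f'E] := factor_surj (f := f) psurj.
  by have [y <-] := pisurj m; apply: fd.
have [g gE] := jext _ _ Qproj f'.
by exists g => x; rewrite /= gE f'E.
Qed.

(** The modules are the kernels of the differentials. A map from such a kernel, composed with the
    preceding cover, kills the differential before it, so Hom-acyclicity yields the extension. *)
Lemma gp_cosyzygies M : gorenstein_projective M ->
  exists K : int -> lmodType R,
    (forall i, cosyzygy (K i) (K (i + 1))) /\ isomorphic M (K 1).
Proof.
move=> [P [Pproj Pac Phom] [j jinj jE]].
exists (fun i => kernel (cdiff P i)); split=> [i|]; last first.
  have [inc [inc_inj incE]] := kernel_incl (cdiff P 1).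
  have [m|f fE] := @factor_inj _ _ _ _ inc j inc_inj.
    by apply/incE; apply/jE; exists m.
  exists f; split=> [x y /(congr1 inc)|y]; first by rewrite !fE => /jinj.
  have /jE[m jm] : cdiff P 1 (inc y) = 0 by apply/incE; exists y.
  by exists m; apply: inc_inj; rewrite fE.
(* Acyclicity and Hom-acyclicity are stated at shifted indices only, so [i] is first brought to the
   shape [i + 1 + 1]. *)
have -> : i = i - 1 - 1 + 1 + 1 by rewrite -!addrA !addNr !addr0.
move: (i - 1 - 1) => {}i.
have [inc [inc_inj incE]] := kernel_incl (cdiff P (i + 1 + 1)).
have [inc' [inc'_inj inc'E]] := kernel_incl (cdiff P (i + 1 + 1 + 1)).
have cover l (inc2 : {linear kernel (cdiff P (l + 1)) -> P (l + 1)}) :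
    injective inc2 ->
    (forall x, cdiff P (l + 1) x = 0 <-> exists m, inc2 m = x) ->
    exists p : {linear P l -> kernel (cdiff P (l + 1))},
    (forall x, inc2 (p x) = cdiff P l x) /\ (forall y, exists x, p x = y).
  move=> inj2 inc2E.
  have [x|p pE] := @factor_inj _ _ _ _ inc2 (cdiff P l) inj2.
    by apply/inc2E; apply: cdiffK.
  exists p; split=> // y.
  have [x xE] : exists x, cdiff P l x = inc2 y by apply/Pac/inc2E; exists y.
  by exists x; apply: inj2; rewrite pE.
have [p' [p'E p'surj]] := cover _ _ inc'_inj inc'E.
have [p [pE psurj]] := cover _ _ inc_inj incE.
exists (P (i + 1 + 1)), inc, p'; split=> //.
  split=> // x; rewrite -incE -p'E; split=> [->|/eqP]; first by rewrite linear0.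
  by rewrite raddf_eq0 // => /eqP.
move=> Q Qproj f.
have [x|g gE] := Phom Q Qproj i (f \o p).
  rewrite /= (_ : p _ = 0) ?linear0 //; apply: inc_inj.
  by rewrite pE cdiffK linear0.
by exists g => m; have [x <-] := psurj m; rewrite pE gE.
Qed.

Lemma cosyzygy_isol M M' N : isomorphic M M' -> cosyzygy M' N -> cosyzygy M N.
Proof.
move=> M'M; have [f' [f'inj f'surj]] := iso_sym M'M.
have [f [fK f'K]] : exists f : {linear M -> M'}, cancel f f' /\ cancel f' f.
  have [f fE] := @factor_inj _ _ _ _ f' (idfun : {linear M -> M}) f'inj f'surj.
  by exists f; split=> [x|x]; [rewrite fE|apply: f'inj; rewrite fE].
move=> [P [j [p [Pproj [jinj psurj pj] jext]]]].
exists P, (j \o f), p; split=> //.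
  split=> // [|x]; first exact: inj_comp jinj (can_inj fK).
  rewrite pj; split=> [[m <-]|[m <-]]; last by exists (f m).
  by exists (f' m); rewrite /= f'K.
move=> Q Qproj g; have [h hE] := jext Q Qproj (g \o f').
by exists h => m; rewrite /= hE /= fK.
Qed.

Lemma cosyzygy_isor M N N' : isomorphic N N' -> cosyzygy M N -> cosyzygy M N'.
Proof.
move=> [f [finj fsurj]] [P [j [p [Pproj [jinj psurj pj] jext]]]].
exists P, j, (f \o p); split=> //; split=> // [y|x].
  by have [x <-] := fsurj y; have [z <-] := psurj x; exists z.
by rewrite -pj /=; split=> [/eqP|->]; rewrite ?linear0 // raddf_eq0 // => /eqP.
Qed.

Lemma gp_next M : gorenstein_projective M ->
  exists N, gorenstein_projective N /\ cosyzygy M N.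
Proof.
move=> /gp_cosyzygies[K [Kco MK]]; exists (K (1 + 1)); split.
  by apply: (@gp_of_cosyzygies (fun i => K (i + 1))) => i.
exact: cosyzygy_isol MK (Kco 1).
Qed.

Lemma gp_prev M : gorenstein_projective M ->
  exists N, gorenstein_projective N /\ cosyzygy N M.
Proof.
move=> /gp_cosyzygies[K [Kco MK]]; exists (K 0); split.
  rewrite -(subrr 1); apply: (@gp_of_cosyzygies (fun i => K (i - 1))) => i.
  by rewrite addrAC; apply: Kco.
by apply: cosyzygy_isor (iso_sym MK) _; have := Kco 0; rewrite add0r.
Qed.

(** Choosing successors and predecessors inside the class, starting from [M], produces a chain
    indexed by all integers, to which [gp_of_cosyzygies] applies. *)
Lemma gp_coind (C : lmodType R -> Prop) :
  (forall M, C M -> exists N, C N /\ cosyzygy M N) ->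
  (forall M, C M -> exists N, C N /\ cosyzygy N M) ->
  forall M, C M -> gorenstein_projective M.
Proof.
move=> Cnext Cprev M CM.
have next (X : {M | C M}) : {Y : {M | C M} | cosyzygy (sval X) (sval Y)}.
  by have [Y [CY ?]] := cid (Cnext _ (svalP X)); exists (exist _ Y CY).
have prev (X : {M | C M}) : {Y : {M | C M} | cosyzygy (sval Y) (sval X)}.
  by have [Y [CY ?]] := cid (Cprev _ (svalP X)); exists (exist _ Y CY).
pose X0 := exist C M CM.
(* [Negz n] stands for [- (n + 1)], hence the [n.+1] backward steps. *)
pose K (i : int) := sval (match i with
  | Posz n => iter n (fun X => sval (next X)) X0
  | Negz n => iter n.+1 (fun X => sval (prev X)) X0
  end).
have Kco i : cosyzygy (K i) (K (i + 1)).
  case: i => n; first by rewrite -PoszD addn1; apply: (svalP (next _)).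
  case: n => [|n]; first exact: (svalP (prev X0)).
  have -> : Negz n.+1 + 1 = Negz n.
    by rewrite !NegzE -[in LHS]addn1 PoszD opprD subrK.
  exact: (svalP (prev _)).
have -> : M = K (1 - 1) by rewrite subrr.
by apply: (@gp_of_cosyzygies (fun i => K (i - 1))) => i; rewrite addrAC.
Qed.

End GorensteinProjective.

(** * Direct sums and retracts *)

Section DirectSums.
Variable R : pzRingType.
Implicit Types M N P Q : lmodType R.

Lemma linear_add M N (f g : {linear M -> N}) :
  exists h : {linear M -> N}, forall x, h x = f x + g x.
Proof. by exists (f \+ g : {linear M -> N}). Qed.

Lemma linear_sub M N (f g : {linear M -> N}) :
  exists h : {linear M -> N}, forall x, h x = f x - g x.
Proof. by exists (f \- g : {linear M -> N}). Qed.

Lemma linear_pair M N Q (f : {linear M -> N}) (g : {linear M -> Q}) :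
  exists h : {linear M -> (N * Q)%type}, forall x, h x = (f x, g x).
Proof. by apply: linear_fun => a x y; rewrite !linearP. Qed.

Lemma linear_copair M N Q (f : {linear M -> Q}) (g : {linear N -> Q}) :
  exists h : {linear (M * N)%type -> Q}, forall x, h x = f x.1 + g x.2.
Proof.
by apply: linear_fun => a x y; rewrite !linearP scalerDr addrACA.
Qed.

Lemma linear_inl M N :
  exists h : {linear M -> (M * N)%type}, forall x, h x = (x, 0).
Proof.
by apply: linear_fun => a x y; congr pair; rewrite /= scaler0 addr0.
Qed.

Lemma linear_inr M N :
  exists h : {linear N -> (M * N)%type}, forall x, h x = (0, x).
Proof.
by apply: linear_fun => a x y; congr pair; rewrite /= scaler0 addr0.
Qed.

Lemma linear_fst M N :
  exists h : {linear (M * N)%type -> M}, forall x, h x = x.1.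
Proof. exact: linear_fun. Qed.

Lemma linear_snd M N :
  exists h : {linear (M * N)%type -> N}, forall x, h x = x.2.
Proof. exact: linear_fun. Qed.

Lemma projective_sum P Q :
  projective P -> projective Q -> projective (P * Q)%type.
Proof.
move=> Pproj Qproj M N g gsurj f.
have [inl inlE] := linear_inl P Q; have [inr inrE] := linear_inr P Q.
have [h1 h1E] := Pproj _ _ g gsurj (f \o inl).
have [h2 h2E] := Qproj _ _ g gsurj (f \o inr).
have [h hE] := linear_copair h1 h2; exists h => -[x y].
rewrite hE linearD h1E h2E /= inlE inrE -linearD; congr (f (_, _)).
  exact: addr0.
exact: add0r.
Qed.

Lemma projective_retract P Q (s : {linear Q -> P}) (r : {linear P -> Q}) :
  cancel s r -> projective P -> projective Q.
Proof.
move=> sK Pproj M N g gsurj f.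
have [h hE] := Pproj _ _ g gsurj (f \o r).
by exists (h \o s) => q; rewrite /= hE /= sK.
Qed.

End DirectSums.

(** * Cancellation of projective summands *)

Section StableEquivalence.
Variable R : pzRingType.
Implicit Types M N P Q : lmodType R.

(* Closing the class under this stable equivalence gives cancellation of a     *)
(* projective summand without any statement on general direct summands.       *)
Definition stably_gp N := exists M Q Q',
  [/\ gorenstein_projective M, projective Q, projective Q'
    & isomorphic (M * Q)%type (N * Q')%type].

Lemma stably_gp_sum M Q :
  gorenstein_projective M -> projective Q -> stably_gp (M * Q)%type.
Proof.
move=> Mgp Qproj; exists M, (Q * Q)%type, Q; split=> //.
  exact: projective_sum.
have [|f fE] := @linear_fun R (M * (Q * Q))%type (M * Q * Q)%type
  (fun x => (x.1, x.2.1, x.2.2)) => //.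
by exists f; split=> [[m [q q']] [n [u u']]|[[m q] q']];
  [rewrite !fE => -[-> -> ->] | exists (m, (q, q')); rewrite fE].
Qed.

(** With M -> P -> M1 a cosyzygy sequence, N embeds in P * Q through N * Q', isomorphic to M * Q;
    the cokernel is M1 * Q'. *)
Lemma stably_gp_next N : stably_gp N ->
  exists N', stably_gp N' /\ cosyzygy N N'.
Proof.
move=> [M [Q [Q' [Mgp Qproj Q'proj [f [finj fsurj]]]]]].
have [M1 [M1gp [P [j [p [Pproj [jinj psurj pj] jext]]]]]] := gp_next Mgp.
exists (M1 * Q')%type; split; first exact: stably_gp_sum.
have [f' f'E] := @factor_inj _ _ _ _ f
  (idfun : {linear (N * Q')%type -> (N * Q')%type}) finj fsurj.
have f'K z : f' (f z) = z by apply: finj; rewrite f'E.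
have [inl inlE] := linear_inl N Q'.
have [pr1 pr1E] := linear_fst N Q'; have [pr2 pr2E] := linear_snd N Q'.
have [inlM inlME] := linear_inl M Q; have [inrQ inrQE] := linear_inr M Q.
have [fstP fstPE] := linear_fst P Q; have [sndP sndPE] := linear_snd P Q.
have [fstM fstME] := linear_fst M Q; have [sndM sndME] := linear_snd M Q.
have splitM (z : (M * Q)%type) : z = inlM z.1 + inrQ z.2.
  by rewrite inlME inrQE; case: z => m q; congr pair; rewrite /= ?addr0 ?add0r.
have extend W (Wproj : projective W) (h : {linear (M * Q)%type -> W}) :
    exists g : {linear (P * Q)%type -> W}, forall m q, g (j m, q) = h (m, q).
  have [g1 g1E] := jext _ Wproj (h \o inlM).
  have [g gE] := linear_copair g1 (h \o inrQ).
  by exists g => m q; rewrite gE /= g1E /= -linearD -(splitM (m, q)).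
(* As Q' is projective, its projection extends from M * Q to P * Q; this gives the Q' component of
   the cokernel map. *)
have [r rE] := extend _ Q'proj (pr2 \o f).
have [i iE] := linear_pair (j \o fstM \o f' \o inl) (sndM \o f' \o inl).
have {}iE n : i n = (j (f' (n, 0)).1, (f' (n, 0)).2).
  by rewrite iE /= inlE fstME sndME.
have [t tE] := linear_pair (p \o fstP) r.
have {}tE z : t z = (p z.1, r z) by rewrite tE /= fstPE.
exists (P * Q)%type, i, t; split; first exact: projective_sum.
  split=> [n n'|[m1 q']|z].
  - rewrite !iE => -[/jinj e1 e2].
    have /(congr1 f) : f' (n, 0) = f' (n', 0).
      by move: e1 e2; case: (f' _) => ? ?; case: (f' _) => ? ? /= -> ->.
    by rewrite !f'E => -[].
  - have [x0 x0E] := psurj m1.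
    have [[m q] mqE] := fsurj (0, q' - r (x0, 0)).
    have [inlP inlPE] := linear_inl P Q.
    exists (inlP x0 + (j m, q)); rewrite tE [r _]linearD rE /= mqE pr2E /=.
    rewrite inlPE linearD /= (_ : p (j m) = 0) ?addr0 ?x0E; last first.
      by apply/pj; exists m.
    by rewrite addrC subrK.
  - rewrite tE; split=> [[/pj[m jm]]|[n <-]]; last first.
      rewrite iE /= rE; case mqE: (f' (n, 0)) => [m q] /=.
      rewrite -mqE f'E /= pr2E; congr pair.
      by apply/pj; exists m.
    case: z jm => x q /= <-; rewrite rE /= pr2E => e.
    exists (f (m, q)).1; rewrite iE.
    have -> : ((f (m, q)).1, 0) = f (m, q) by case: (f _) e => ? ? /= ->.
    by rewrite f'K.
move=> W Wproj g; have [h hE] := extend _ Wproj (g \o pr1 \o f).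
exists h => n; rewrite iE hE /= -surjective_pairing f'E pr1E.
by [].
Qed.

(** P * Q maps onto N * Q' with kernel M0. The composite onto N has as kernel the preimage of Q',
    and this splits as M0 * Q' because Q' is projective. *)
Lemma stably_gp_prev N : stably_gp N ->
  exists N', stably_gp N' /\ cosyzygy N' N.
Proof.
move=> [M [Q [Q' [Mgp Qproj Q'proj [f [finj fsurj]]]]]].
have [M0 [M0gp [P [j [p [Pproj [jinj psurj pj] jext]]]]]] := gp_prev Mgp.
exists (M0 * Q')%type; split; first exact: stably_gp_sum.
have [pr1 pr1E] := linear_fst N Q'; have [pr2 pr2E] := linear_snd N Q'.
have [inlM inlME] := linear_inl M0 Q'; have [inrQ inrQE] := linear_inr M0 Q'.
have [fstP fstPE] := linear_fst P Q; have [sndP sndPE] := linear_snd P Q.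
have [inlP inlPE] := linear_inl P Q.
have [inr inrE] := linear_inr N Q'.
have [pq pqE] := linear_pair (p \o fstP) sndP.
have [F FE] : exists F : {linear (P * Q)%type -> (N * Q')%type},
    forall z, F z = f (p z.1, z.2).
  by exists (f \o pq) => z; rewrite /= pqE /= fstPE sndPE.
have Fsurj y : exists x, F x = y.
  have [[m q] <-] := fsurj y; have [x <-] := psurj m.
  by exists (x, q); rewrite FE.
have Fj m : F (j m, 0) = 0.
  by rewrite FE /= (_ : p _ = 0) ?[f _]linear0 //; apply/pj; exists m.
have [s sE] := Q'proj _ _ F Fsurj inr.
have {}sE q : F (s q) = (0, q) by rewrite sE inrE.
have [k kE] := linear_copair (inlP \o j) s.
have {}kE z : k z = (j z.1, 0) + s z.2 by rewrite kE /= inlPE.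
have Fk z : F (k z) = (0, z.2) by rewrite kE linearD Fj sE add0r.
exists (P * Q)%type, k, (pr1 \o F); split; first exact: projective_sum.
  split=> [|n|x].
  - apply: raddf_inj => -[m q] kz0.
    have q0 : q = 0 by have := Fk (m, q); rewrite kz0 linear0 => /(congr1 snd).
    have := kE (m, q); rewrite kz0 /= q0 linear0 addr0 => /(congr1 fst)/= jm0.
    by congr pair; apply: jinj; rewrite -jm0 linear0.
  - by have [x xE] := Fsurj (n, 0); exists x; rewrite /= xE pr1E.
  rewrite /= pr1E; split=> [Fx|[z <-]]; last by rewrite Fk.
  have : F (x - s (F x).2) = 0.
    rewrite linearB sE; move: Fx; case: (F x) => u v /= ->.
    by congr pair; rewrite /= subrr.
  move/eqP; rewrite FE raddf_eq0 // => /eqP[/pj[m jm] x2].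
  exists (m, (F x).2); rewrite kE -[LHS]addrC [X in _ + X = _](_ : _ = x - s (F x).2).
    by rewrite addrC subrK.
  by rewrite [RHS]surjective_pairing; congr pair; [exact: jm | exact: esym].
move=> W Wproj g.
have [g0 g0E] := jext _ Wproj (g \o inlM).
(* [g0] extends [g] from M0 only; [u] measures its error on the lifted copy of Q' and is added back
   through the Q' component of [F]. *)
have [u uE] := linear_sub (g \o inrQ) (g0 \o fstP \o s).
have [h hE] := linear_add (g0 \o fstP) (u \o pr2 \o F).
exists h => -[m q]; rewrite hE /= Fk pr2E uE /= !fstPE kE [g0 _]linearD /= g0E /=.
rewrite -addrA [g0 _ + _]addrC subrK -linearD inlME inrQE; congr (g (_, _)).
  exact: addr0.
exact: add0r.
Qed.

Lemma gp_stable M N Q Q' : gorenstein_projective M ->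
  projective Q -> projective Q' ->
  isomorphic (M * Q)%type (N * Q')%type -> gorenstein_projective N.
Proof.
move=> Mgp Qproj Q'proj MN.
by apply: (gp_coind stably_gp_next stably_gp_prev); exists M, Q, Q'.
Qed.

End StableEquivalence.

(** * Schanuel's lemma and its consequences for Gorenstein projectives *)

Section Schanuel.
Variable R : pzRingType.
Implicit Types K M N P Q : lmodType R.

(** Both sums are the pushout of [i] and [j]: it is N * P' by means of [b], and N' * P by means of
    [a]. The formula is the composite (p y, x) -> [y, x - b y] -> (p' (x - b y), y + a (x - b
    y)). *)
Lemma cokernel_maps M P P' N N' (i : {linear M -> P}) (p : {linear P -> N})
    (j : {linear M -> P'}) (p' : {linear P' -> N'})
    (a : {linear P' -> P}) (b : {linear P -> P'}) :
  short_exact i p -> short_exact j p' ->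
  (forall m, a (j m) = i m) -> (forall m, b (i m) = j m) ->
  exists f : {linear (N * P')%type -> (N' * P)%type}, forall y x,
    f (p y, x) = (p' (x - b y), a x + (y - a (b y))).
Proof.
move=> [_ psurj pi] [_ p'surj p'j] aj bi.
have [fst fstE] := linear_fst N P'; have [snd sndE] := linear_snd N P'.
have [y /pi[m <-]|b' b'E] := factor_surj (f := p' \o b) psurj.
  by rewrite /= bi; apply/p'j; exists m.
have [e eE] := linear_sub (idfun : {linear P -> P}) (a \o b).
have [y /pi[m <-]|c cE] := factor_surj (f := e) psurj.
  by rewrite eE /= bi aj subrr.
have [f1 f1E] := linear_sub (p' \o snd) (b' \o fst).
have [f2 f2E] := linear_add (a \o snd) (c \o fst).
have [f fE] := linear_pair f1 f2; exists f => y x.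
by rewrite fE f1E f2E /= sndE fstE b'E cE eE /= linearB.
Qed.

Lemma schanuel_cokernel M P P' N N' (i : {linear M -> P}) (p : {linear P -> N})
    (j : {linear M -> P'}) (p' : {linear P' -> N'}) :
  short_exact i p -> short_exact j p' ->
  (exists a : {linear P' -> P}, forall m, a (j m) = i m) ->
  (exists b : {linear P -> P'}, forall m, b (i m) = j m) ->
  isomorphic (N * P')%type (N' * P)%type.
Proof.
move=> ip jp' [a aj] [b bi].
have [f fE] := cokernel_maps ip jp' aj bi.
have [g gE] := cokernel_maps jp' ip bi aj.
have cancelling (V : zmodType) (A s t : V) : A + (s - t) - (A - t) = s.
  by rewrite opprB addrA -[_ + t]addrA subrK addrAC subrr add0r.
have cancelling' (V : zmodType) (u v w x : V) : u + (v - w) + (x - v - (u - w)) = x.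
  rewrite -[x - v - _]addrA -opprD [v + (u - w)]addrCA.
  exact: etrans (addrC _ _) (subrK _ _).
apply: (@iso_cancel _ _ _ f g) => -[n x].
  have [_ /(_ n)[y <-] _] := ip; rewrite fE gE.
  congr pair; first by rewrite (linearB a) cancelling.
  by rewrite (linearB a) (linearD b) !(linearB b) cancelling'.
have [_ /(_ n)[y <-] _] := jp'; rewrite gE fE.
congr pair; first by rewrite (linearB b) cancelling.
by rewrite (linearB b) (linearD a) !(linearB a) cancelling'.
Qed.

(** Both sums are the pullback of [p] and [p']: the pair (k, y) corresponds to (i k + b y, y), and
    (k', u) to (u, j k' + a u). *)
Lemma kernel_maps P P' M K K' (i : {linear K -> P}) (p : {linear P -> M})
    (j : {linear K' -> P'}) (p' : {linear P' -> M})
    (a : {linear P -> P'}) (b : {linear P' -> P}) :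
  short_exact i p -> short_exact j p' ->
  (forall x, p' (a x) = p x) -> (forall x, p (b x) = p' x) ->
  exists f : {linear (K * P')%type -> (K' * P)%type}, forall z,
    (f z).2 = i z.1 + b z.2 /\ j (f z).1 = z.2 - a (f z).2.
Proof.
move=> [_ _ pi] [jinj _ p'j] p'a pb.
have [fst fstE] := linear_fst K P'; have [snd sndE] := linear_snd K P'.
have [f2 f2E] := linear_add (i \o fst) (b \o snd).
have [e eE] := linear_sub snd (a \o f2).
have [x|f1 f1E] := @factor_inj _ _ _ _ j e jinj.
  apply/p'j; rewrite eE sndE linearB /= p'a f2E linearD /= pb sndE fstE.
  by rewrite (_ : p (i _) = 0) ?add0r ?subrr //; apply/pi; exists x.1.
have [f fE] := linear_pair f1 f2; exists f => z.
by rewrite fE; split; rewrite /= ?f1E ?eE /= ?f2E /= ?fstE ?sndE.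
Qed.

Lemma schanuel_kernel P P' M K K' (i : {linear K -> P}) (p : {linear P -> M})
    (j : {linear K' -> P'}) (p' : {linear P' -> M}) :
  short_exact i p -> short_exact j p' ->
  (exists a : {linear P -> P'}, forall x, p' (a x) = p x) ->
  (exists b : {linear P' -> P}, forall x, p (b x) = p' x) ->
  isomorphic (K * P')%type (K' * P)%type.
Proof.
move=> ip jp' [a p'a] [b pb].
have [f fE] := kernel_maps ip jp' p'a pb.
have [g gE] := kernel_maps jp' ip pb p'a.
have [iinj _ _] := ip; have [jinj _ _] := jp'.
apply: (@iso_cancel _ _ _ f g) => -[k y].
  have [f2 f1] := fE (k, y); have [g2 g1] := gE (f (k, y)).
  have g2E : (g (f (k, y))).2 = y by rewrite g2 f1 subrK.
  rewrite [LHS]surjective_pairing g2E; congr pair; apply: iinj.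
  by rewrite g1 g2E f2 addrK.
have [f2 f1] := gE (k, y); have [g2 g1] := fE (g (k, y)).
have g2E : (f (g (k, y))).2 = y by rewrite g2 f1 subrK.
rewrite [LHS]surjective_pairing g2E; congr pair; apply: jinj.
by rewrite g1 g2E f2 addrK.
Qed.

Lemma gp_cokernel M P N (j : {linear M -> P}) (p : {linear P -> N}) :
  gorenstein_projective M -> projective P -> short_exact j p ->
  proj_extends j -> gorenstein_projective N.
Proof.
move=> Mgp Pproj jp jext.
have [N' [N'gp [P' [i [p' [P'proj ip' iext]]]]]] := gp_next Mgp.
by apply: (gp_stable N'gp Pproj P'proj); apply: schanuel_cokernel ip' jp _ _;
  [apply: jext | apply: iext].
Qed.

(** The second conclusion says that Ext^1(M, Q) vanishes for projective Q, for whichever projective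
    presentation of M; it is transported from the sequence of [gp_prev]. *)
Lemma gp_kernel M P K (j : {linear K -> P}) (p : {linear P -> M}) :
  gorenstein_projective M -> projective P -> short_exact j p ->
  gorenstein_projective K /\ proj_extends j.
Proof.
move=> Mgp Pproj jp; have [jinj psurj pj] := jp.
have [K' [K'gp [P' [i [p' [P'proj ip' iext]]]]]] := gp_prev Mgp.
have [iinj p'surj p'i] := ip'.
have [a aE] := Pproj _ _ p' p'surj p; have [b bE] := P'proj _ _ p psurj p'.
split.
  by apply: (gp_stable K'gp Pproj P'proj);
    apply: schanuel_kernel ip' jp _ _; [exists b | exists a].
move=> Q Qproj f.
have [x|b' b'E] := @factor_inj _ _ _ _ j (b \o i) jinj.
  by apply/pj; rewrite bE; apply/p'i; exists x.
have [x|a' a'E] := @factor_inj _ _ _ _ i (a \o j) iinj.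
  by apply/p'i; rewrite aE; apply/pj; exists x.
have [g gE] := iext Q Qproj (f \o b').
(* The endomorphism 1 - b a of P lands in K. On K it is 1 - b' a', so the missing part f b' a' is
   supplied by [g \o a]. *)
have [e eE] := linear_sub (idfun : {linear P -> P}) (b \o a).
have [x|e' e'E] := @factor_inj _ _ _ _ j e jinj.
  by apply/pj; rewrite eE linearB /= bE aE subrr.
have [h hE] := linear_add (f \o e') (g \o a).
exists h => k; rewrite hE /= -[a (j k)]a'E gE /= -linearD; congr (f _).
by apply: jinj; rewrite linearD /= e'E eE b'E /= a'E /= subrK.
Qed.

End Schanuel.

(** * Vector spaces and free modules *)

Section VectorSpaces.
Variable k : fieldType.
Implicit Types U V W : lmodType k.

(** Zorn's lemma yields a complement S of the image of [i]; the retraction reads off the image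
    component. *)
Lemma vect_retraction U V (i : {linear U -> V}) : injective i ->
  exists r : {linear V -> U}, forall u, r (i u) = u.
Proof.
move=> iinj.
pose C (S : set V) := (forall a x y, S x -> S y -> S (a *: x + y)) /\
  (forall u, S (i u) -> u = 0).
have [|S [[Slin Si] Smax]] := @Zorn_bigcup V C.
  move=> F FC Ftot; split=> [a x y [X FX Xx] [Y FY Yy]|u [X FX Xu]]; last first.
    by have [_] := FC X FX; apply.
  have [XY|YX] := Ftot X Y FX FY.
    by exists Y => //; have [Ylin _] := FC Y FY; apply: Ylin => //; apply: XY.
  by exists X => //; have [Xlin _] := FC X FX; apply: Xlin => //; apply: YX.
(* The empty set satisfies [C], as the empty chain demands, so that S contains 0 must come from
   maximality. *)
have S0 : S 0.
  apply: contrapT => nS0; apply: (Smax (fun x => x = 0)).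
    split=> [x Sx|sub]; last by apply/nS0/sub.
    by case: nS0; rewrite -(subrr x) addrC -scaleN1r; apply: Slin.
  split=> [a x y -> ->|u]; first by rewrite scaler0 addr0.
  by move/eqP; rewrite raddf_eq0 // => /eqP.
have SZ a x : S x -> S (a *: x) by move=> Sx; rewrite -[_ *: _]addr0; apply: Slin.
(* Otherwise S + k v would be a larger subspace still meeting the image trivially. *)
have compl v : exists u, S (v - i u).
  apply: contrapT => /forallNP noS.
  apply: (Smax (fun x => exists c, S (x - c *: v))).
    split=> [x Sx|sub]; first by exists 0; rewrite scale0r subr0.
    apply: (noS 0); rewrite linear0 subr0; apply: sub.
    by exists 1; rewrite scale1r subrr.
  split=> [a x y [c Sx] [d Sy]|u [c Sc]].
    exists (a * c + d); have := Slin a _ _ Sx Sy.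
    by rewrite scalerBr scalerA scalerDl opprD addrACA.
  have [c0|c_neq0] := eqVneq c 0.
    by apply: Si; move: Sc; rewrite c0 scale0r subr0.
  case: (noS (c^-1 *: u)); have := SZ (- c^-1) _ Sc.
  by rewrite scaleNr scalerBr scalerA mulVf // scale1r opprB [i (_ *: _)]linearZ.
have [r rS] := choice compl.
have uniq v u : S (v - i u) -> r v = u.
  move=> Su; apply/eqP; rewrite -subr_eq0; apply/eqP/Si.
  have := Slin (-1) _ _ (rS v) Su.
  by rewrite scaleN1r opprB addrA subrK linearB.
have [|h hE] := @linear_fun k V U r.
  move=> a x y; apply: uniq; have := Slin a _ _ (rS x) (rS y).
  by rewrite scalerBr linearP opprD addrACA.
by exists h => u; rewrite hE; apply: uniq; rewrite subrr.
Qed.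

Lemma vect_injective W : injective_module W.
Proof.
move=> U V i /vect_retraction[r rE] f.
by exists (f \o r) => u; rewrite /= rE.
Qed.

Lemma vect_projective W : projective W.
Proof.
move=> M N g gsurj f.
have [i [iinj iE]] := kernel_incl g; have [r rE] := vect_retraction iinj.
have [e eE] := linear_sub (idfun : {linear M -> M}) (i \o r).
have [x /iE[m <-]|s sE] := factor_surj (f := e) gsurj.
  by rewrite eE /= rE subrr.
exists (s \o f) => q /=; have [x <-] := gsurj (f q).
rewrite sE eE linearB /= (_ : g (i _) = 0) ?subr0 //.
by apply/iE; exists (r x).
Qed.

End VectorSpaces.

Section FreeModules.
Variable R : nzRingType.
Import freeg.

Lemma fglift_linear (M : lmodType R) (K : choiceType) (f : K -> M) :
  linear (fglift f : {freeg K / R} -> M).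
Proof.
have fgB D E : fglift f (D - E) = fglift f D - fglift f E.
  exact: lift_is_additive.
have fg0 : fglift f 0 = 0 by rewrite -(subrr 0) fgB subrr.
have fgD D E : fglift f (D + E) = fglift f D + fglift f E.
  have fgN : fglift f (- E) = - fglift f E by rewrite -sub0r fgB fg0 sub0r.
  by rewrite -{1}[E]opprK fgB fgN opprK.
have fgsum s c : fglift f (\sum_(z <- s) << c z *g z >>) = \sum_(z <- s) c z *: f z.
  by rewrite (big_morph _ fgD fg0); apply: eq_bigr => z _; rewrite liftU.
move=> a D E; rewrite fgD; congr (_ + _).
rewrite [a *: D]/(fgscale a D) /fgscale fgsum -[in RHS](freeg_sumE D) fgsum scaler_sumr.
by apply: eq_bigr => z _; rewrite scalerA.
Qed.

Lemma projective_freeg (K : choiceType) : projective ({freeg K / R} : lmodType R).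
Proof.
move=> M N g gsurj f.
have /choice[s sE] (z : K) : exists x, g x = f << z >> by apply: gsurj.
have [h hE] := linear_fun (fglift_linear s).
exists h => D; rewrite -(freeg_sumE D) !linear_sum; apply: eq_bigr => z _.
have -> : << coeff z D *g z >> = coeff z D *: << z >> :> {freeg K / R}.
  by apply/eqP/freeg_eqP => x; rewrite coeffZ !coeffU mul1r.
by rewrite !linearZ hE liftU scale1r sE.
Qed.

Lemma enough_projectives (M : lmodType R) :
  exists (P : lmodType R) (p : {linear P -> M}),
    projective P /\ forall y, exists x, p x = y.
Proof.
have [p pE] := linear_fun (fglift_linear (idfun : M -> M)).
exists _, p; split=> [|y]; first exact: projective_freeg.
by exists << y >>; rewrite pE liftU scale1r.
Qed.
End FreeModules.

(** * Coinduction from k to B *)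

Section DualBasis.
Variables (k : fieldType) (B : falgType k).

Definition dapp (phi : dual B) (x : B) : k := (phi : 'Hom(B, k^o)) x.

Lemma dappDl phi psi x : dapp (phi + psi) x = dapp phi x + dapp psi x.
Proof. by rewrite /dapp [LHS]add_lfunE. Qed.

Lemma dapp_scale (b : B) phi x : dapp ((b : B^c) *: phi) x = dapp phi (b * x).
Proof. exact: dual_scaleE. Qed.

Lemma dappDr phi x y : dapp phi (x + y) = dapp phi x + dapp phi y.
Proof. exact: (linearD (phi : 'Hom(B, k^o))). Qed.

Lemma dappZr phi c x : dapp phi (c *: x) = c * dapp phi x.
Proof. by have := linearZ_LR (phi : 'Hom(B, k^o)) c x. Qed.

(** [dual B] carries only its right B-action, so k-scalars act on it through [c%:A]. *)
Lemma dapp_alg c phi x : dapp ((c%:A : B^c) *: phi) x = c * dapp phi x.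
Proof. by rewrite dapp_scale -scalerAl mul1r dappZr. Qed.

Lemma dapp_inj phi psi : dapp phi =1 dapp psi -> phi = psi.
Proof. by move=> e; apply/lfunP. Qed.

Local Notation n := (\dim {:B}).
Local Notation e := (vbasis {:B}).

Definition dual_basis (i : 'I_n) : dual B := linfun (coord e i : B -> k^o).

Lemma dual_basisE i x : dapp (dual_basis i) x = coord e i x.
Proof. by rewrite /dapp lfunE. Qed.

Lemma basis_expand (x : B) : x = \sum_(i < n) coord e i x *: e`_i.
Proof. exact/coord_vbasis/memvf. Qed.

Lemma dual_expand (phi : dual B) :
  phi = \sum_(i < n) (((dapp phi e`_i)%:A : B^c) *: dual_basis i).
Proof.
apply: dapp_inj => x.
have -> : dapp (\sum_(i < n) (((dapp phi e`_i)%:A : B^c) *: dual_basis i)) x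
   = \sum_(i < n) dapp phi e`_i * coord e i x.
  rewrite (big_morph (fun f => dapp f x) (fun f g => dappDl f g x) (id1 := 0)).
    by apply: eq_bigr => i _; rewrite dapp_alg dual_basisE.
  by rewrite /dapp zero_lfunE.
rewrite {1}(basis_expand x) [LHS](linear_sum (phi : 'Hom(B, k^o))).
by apply: eq_bigr => i _; rewrite mulrC; apply: dappZr.
Qed.

Lemma dual_scale_alg (b : B) (c : k) (phi : dual B) :
  (b : B^c) *: ((c%:A : B^c) *: phi) = (c%:A : B^c) *: ((b : B^c) *: phi).
Proof. by apply: dapp_inj => x; rewrite dapp_scale [LHS]dapp_alg [RHS]dapp_alg dapp_scale. Qed.

End DualBasis.

Section Coinduction.
Variables (k : fieldType) (B : falgType k).
Local Notation n := (\dim {:B}).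
Local Notation e := (vbasis {:B}).

Section Carrier.
Variable V : lmodType k.

(* Hom_k(DB, V) in coordinates: v stands for the k-linear map ev v taking the *)
(* i-th element of the basis dual to e to v i.                                *)
Definition coind : Type := {ffun 'I_n -> V}.
HB.instance Definition _ := GRing.Zmodule.on coind.

Definition dlinear (g : dual B -> V) : Prop :=
  (forall phi psi, g (phi + psi) = g phi + g psi) /\
  (forall c phi, g ((c%:A : B^c) *: phi) = c *: g phi).

Definition ev (v : coind) (phi : dual B) : V :=
  \sum_(i < n) dapp phi e`_i *: (v : {ffun 'I_n -> V}) i.

Definition coev (g : dual B -> V) : coind := [ffun i => g (dual_basis i)].

Lemma ev_dlinear v : dlinear (ev v).
Proof.
split=> [phi psi|c phi]; rewrite /ev.
  by rewrite -big_split; apply: eq_bigr => i _; rewrite dappDl scalerDl.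
by rewrite scaler_sumr; apply: eq_bigr => i _; rewrite dapp_alg scalerA.
Qed.

Lemma coevK g : dlinear g -> forall phi, ev (coev g) phi = g phi.
Proof.
move=> [gD gZ] phi; rewrite {2}(dual_expand phi).
have g0 : g 0 = 0 by apply: (addrI (g 0)); rewrite -gD !addr0.
rewrite (big_morph _ gD g0); apply: eq_bigr => i _.
by rewrite ffunE gZ.
Qed.

Lemma ev_dual_basis v i : ev v (dual_basis i) = (v : {ffun 'I_n -> V}) i.
Proof.
rewrite /ev (bigD1 i) //= dual_basisE big1 ?addr0 => [|j ji].
  by rewrite coord_free ?(basis_free (vbasisP _)) // eqxx scale1r.
rewrite dual_basisE coord_free ?(basis_free (vbasisP _)) //.
by rewrite (negPf ji) scale0r.
Qed.

Lemma ev_inj v w : (forall phi, ev v phi = ev w phi) -> v = w.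
Proof. by move=> evw; apply/ffunP => i; rewrite -!ev_dual_basis. Qed.

Lemma evDl v w phi : ev (v + w) phi = ev v phi + ev w phi.
Proof.
by rewrite -big_split; apply: eq_bigr => i _; rewrite ffunE scalerDr.
Qed.

(** The left B-action on Hom_k(DB, V) coming from the right action on DB. *)
Definition coind_scale (b : B) (v : coind) : coind :=
  coev (fun phi => ev v ((b : B^c) *: phi)).

Lemma ev_coind_scale b v phi : ev (coind_scale b v) phi = ev v ((b : B^c) *: phi).
Proof.
have [evD evZ] := ev_dlinear v.
apply: (coevK (g := fun phi => ev v ((b : B^c) *: phi))).
by split=> [psi1 psi2|c psi]; rewrite ?scalerDr ?evD // dual_scale_alg evZ.
Qed.

Fact coind_scaleA a b v : coind_scale a (coind_scale b v) = coind_scale (a * b) v.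
Proof. by apply: ev_inj => phi; rewrite !ev_coind_scale scalerA. Qed.
Fact coind_scale1 : left_id 1 coind_scale.
Proof. by move=> v; apply: ev_inj => phi; rewrite ev_coind_scale scale1r. Qed.
Fact coind_scaleDr : right_distributive coind_scale +%R.
Proof. by move=> a v w; apply: ev_inj => phi; rewrite !(evDl, ev_coind_scale). Qed.
Fact coind_scaleDl v : {morph coind_scale^~ v : a b / a + b}.
Proof.
move=> a b; apply: ev_inj => phi; rewrite evDl !ev_coind_scale scalerDl.
by have [evD _] := ev_dlinear v; rewrite evD.
Qed.

HB.instance Definition _ := GRing.Zmodule_isLmodule.Build B coind
  coind_scaleA coind_scale1 coind_scaleDr coind_scaleDl.

Lemma evZ (b : B) (v : coind) phi : ev (b *: v) phi = ev v ((b : B^c) *: phi).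
Proof. exact: ev_coind_scale. Qed.

End Carrier.
End Coinduction.

Section KTensor.
Variables (k : fieldType) (B : falgType k) (Y : lmodType B).

(** The counterpart of [dual_tensor] over [k]. For Y = [restrict_r X] it has the same carrier as
    [dual_tensor X], so [tmap] serves both. *)
Definition ktensor : Type := tensor (dual B : lmodType B^c) Y.
HB.instance Definition _ := GRing.Zmodule.on ktensor.

Definition ktensor_scale (c : k) (t : ktensor) : ktensor :=
  tlift (fun (phi : dual B) (y : Y) => tens phi ((c%:A : B) *: y)) t.

Fact ktensor_scale_balanced (c : k) :
  balanced (fun (phi : dual B) (y : Y) => tens phi ((c%:A : B) *: y)).
Proof.
split=> [f f' x|f x x'|f b x]; first exact: tensDl.
  by rewrite scalerDr tensDr.
by rewrite tens_bal !scalerA -scalerAl -scalerAr mul1r mulr1.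
Qed.

Lemma ktensor_scaleE c phi y :
  ktensor_scale c (tens phi y) = tens phi ((c%:A : B) *: y).
Proof. by rewrite /ktensor_scale tliftE //; apply: ktensor_scale_balanced. Qed.

Fact ktensor_scaleDr : right_distributive ktensor_scale +%R.
Proof. by move=> c x y; apply/tliftD/ktensor_scale_balanced. Qed.
Fact ktensor_scale0r c : ktensor_scale c 0 = 0.
Proof. exact/tlift0/ktensor_scale_balanced. Qed.
Fact ktensor_scaleA a b t :
  ktensor_scale a (ktensor_scale b t) = ktensor_scale (a * b) t.
Proof.
elim/tensor_ind: t => [|f x t IHt]; first by rewrite !ktensor_scale0r.
rewrite !ktensor_scaleDr IHt !ktensor_scaleE scalerA.
by rewrite -scalerAl mul1r scalerA.
Qed.
Fact ktensor_scale1 : left_id 1 ktensor_scale.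
Proof.
elim/tensor_ind => [|f x t IHt]; first exact: ktensor_scale0r.
by rewrite ktensor_scaleDr IHt ktensor_scaleE !scale1r.
Qed.
Fact ktensor_scaleDl t : {morph ktensor_scale^~ t : a b / a + b}.
Proof.
move=> a b; rewrite /ktensor_scale -tlift_add; apply: eq_tlift => f x.
by rewrite !scalerDl tensDr.
Qed.

HB.instance Definition _ := GRing.Zmodule_isLmodule.Build k ktensor
  ktensor_scaleA ktensor_scale1 ktensor_scaleDr ktensor_scaleDl.

End KTensor.

Section CoinductionProjective.
Variables (k : fieldType) (B : falgType k).
Local Notation n := (\dim {:B}).
Local Notation e := (vbasis {:B}).

Section Generator.
Variable V : lmodType k.

(** The element 1 (x) q when Hom_k(DB, V) is identified with the tensor product of B and V over
    k. *)
Definition coind_gen (q : V) : coind B V := coev (fun phi => dapp phi 1 *: q).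

Lemma ev_coind_gen q phi : ev (coind_gen q) phi = dapp phi 1 *: q.
Proof.
apply: (coevK (g := fun phi => dapp phi 1 *: q)); split=> [f g|c f].
  by rewrite dappDl scalerDl.
by rewrite dapp_alg scalerA.
Qed.

Lemma coind_genD q q' : coind_gen (q + q') = coind_gen q + coind_gen q'.
Proof. by apply: ev_inj => phi; rewrite evDl !ev_coind_gen scalerDr. Qed.

Lemma coind_genZ c q : coind_gen (c *: q) = (c%:A : B) *: coind_gen q.
Proof.
apply: ev_inj => phi; rewrite evZ !ev_coind_gen dapp_scale mulr1 dappZr.
by rewrite scalerA mulrC.
Qed.

Lemma ev_sum (I : Type) (r : seq I) (F : I -> coind B V) phi :
  ev (\sum_(i <- r) F i) phi = \sum_(i <- r) ev (F i) phi.
Proof.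
apply: (big_morph (fun v => ev v phi) (fun v w => evDl v w phi)).
by apply: (addrI (ev 0 phi)); rewrite -evDl !addr0.
Qed.

Lemma coind_expand (v : coind B V) :
  v = \sum_(i < n) e`_i *: coind_gen ((v : {ffun 'I_n -> V}) i).
Proof.
apply: ev_inj => phi; rewrite ev_sum; apply: eq_bigr => i _.
by rewrite evZ ev_coind_gen dapp_scale mulr1.
Qed.

Lemma coind_ind (C : coind B V -> Prop) :
  C 0 -> (forall v w, C v -> C w -> C (v + w)) ->
  (forall b q, C (b *: coind_gen q)) -> forall v, C v.
Proof.
move=> C0 CD Cgen v; rewrite (coind_expand v).
by elim/big_ind: _ => // i _; apply: Cgen.
Qed.

(** The universal property of the induced module: k-linear maps V -> N extend to B-linear ones.
    B-linearity of [h] compares the structure constants of multiplication by [b] in the basis. *)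
Lemma coind_lift (N : lmodType B) (theta : V -> N) :
  (forall q q', theta (q + q') = theta q + theta q') ->
  (forall c q, theta (c *: q) = (c%:A : B) *: theta q) ->
  exists h : {linear coind B V -> N}, forall q, h (coind_gen q) = theta q.
Proof.
move=> thetaD thetaZ.
have theta0 : theta 0 = 0 by apply: (addrI (theta 0)); rewrite -thetaD !addr0.
pose h (v : coind B V) := \sum_(i < n) e`_i *: theta ((v : {ffun 'I_n -> V}) i).
have hD v w : h (v + w) = h v + h w.
  by rewrite -big_split; apply: eq_bigr => i _; rewrite ffunE thetaD scalerDr.
have hZ b v : h (b *: v) = b *: h v.
  have bvE i : ((b *: v : coind B V) : {ffun 'I_n -> V}) i =
      \sum_(j < n) coord e i (b * e`_j) *: (v : {ffun 'I_n -> V}) j.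
    rewrite -ev_dual_basis evZ; apply: eq_bigr => j _.
    by rewrite dapp_scale dual_basisE.
  rewrite /h scaler_sumr.
  under eq_bigr => i _ do
    rewrite bvE (big_morph _ thetaD theta0) scaler_sumr.
  rewrite exchange_big; apply: eq_bigr => j _ /=.
  rewrite scalerA [in RHS](basis_expand (b * e`_j)) scaler_suml.
  apply: eq_bigr => i _; rewrite thetaZ scalerA.
  by rewrite -scalerAr mulr1.
have [|h' h'E] := @linear_fun _ (coind B V) N h.
  by move=> b v w; rewrite hD hZ.
exists h' => q; rewrite h'E /h -[RHS]scale1r.
rewrite [in RHS](basis_expand 1) scaler_suml; apply: eq_bigr => i _.
by rewrite -ev_dual_basis ev_coind_gen thetaZ dual_basisE scalerA -scalerAr mulr1.
Qed.

End Generator.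

(** Induction is left adjoint to the exact restriction to [k], where every module is projective. *)
Lemma coind_projective (V : lmodType k) : projective (coind B V).
Proof.
move=> M N g gsurj f.
have fgen : linear (fun q => f (coind_gen q) : restriction (GRing.in_alg B) N).
  by move=> c q q'; rewrite coind_genD coind_genZ linearD linearZ.
have [fg fgE] := linear_fun fgen.
have glin : linear (g : restriction (GRing.in_alg B) M -> restriction (GRing.in_alg B) N).
  by move=> c x y; exact: (linearP g c%:A x y).
have [g' g'E] := linear_fun glin.
have [|theta thetaE] := @vect_projective k V _ _ g' _ fg.
  by move=> y; have [x <-] := gsurj y; exists x; rewrite g'E.
have [||h hE] := @coind_lift V M theta.
- exact: linearD.
- by move=> c q; rewrite linearZ.
exists h; elim/coind_ind => [|v w|b q]; first by rewrite !linear0.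
  by rewrite !linearD => -> ->.
rewrite !linearZ /= hE; congr (_ *: _).
by rewrite -[RHS]fgE -thetaE g'E.
Qed.

Lemma projective_coind_retract (Q : lmodType B) : projective Q ->
  exists (V : lmodType k) (s : {linear Q -> coind B V}) (r : {linear coind B V -> Q}),
    cancel s r.
Proof.
move=> Qproj; exists (restriction (GRing.in_alg B) Q).
have [||r rE] := @coind_lift (restriction (GRing.in_alg B) Q) Q idfun => //.
have [|s sE] := Qproj _ _ r _ (idfun : {linear Q -> Q}); last by exists s, r.
by move=> y; exists (coind_gen (y : restriction (GRing.in_alg B) Q)); rewrite rE.
Qed.

End CoinductionProjective.

Section KAdjunction.
Variables (k : fieldType) (B : falgType k) (Y : lmodType B) (V : lmodType k).

(** One half of the tensor-Hom adjunction; [ktensor_coadj] is the other. *)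
Lemma ktensor_adj (u : {linear ktensor Y -> V}) :
  exists l : {linear Y -> coind B V}, forall y phi, ev (l y) phi = u (tens phi y).
Proof.
pose l y : coind B V := coev (fun phi => u (tens phi y)).
have lE y phi : ev (l y) phi = u (tens phi y).
  apply: (coevK (g := fun phi => u (tens phi y))); split=> [f g|c f].
    by rewrite -linearD; congr (u _); apply: tensDl.
  rewrite -linearZ; congr (u _); rewrite tens_bal.
  by rewrite -ktensor_scaleE.
have [|l' l'E] := @linear_fun _ Y (coind B V) l.
  move=> b y y'; apply: ev_inj => phi.
  by rewrite evDl evZ !lE -linearD tens_bal; congr (u _); apply: tensDr.
by exists l' => y phi; rewrite l'E.
Qed.

Lemma ktensor_coadj (l : {linear Y -> coind B V}) :
  exists u : {linear ktensor Y -> V}, forall y phi, u (tens phi y) = ev (l y) phi.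
Proof.
have bal : balanced (fun (phi : dual B) y => ev (l y) phi).
  split=> [f g y|f y y'|f b y].
  - by have [evD _] := ev_dlinear (l y); rewrite evD.
  - by rewrite linearD evDl.
  - by rewrite linearZ evZ.
have uE phi y : tlift (fun (phi : dual B) y => ev (l y) phi) (tens phi y) = ev (l y) phi.
  exact: tliftE.
have [|u u'E] := @linear_fun k (ktensor Y) V (tlift (fun (phi : dual B) y => ev (l y) phi)).
  move=> c x y; rewrite [LHS](tliftD bal); congr (_ + _).
  elim/tensor_ind: x => [|phi z x IHx]; first by rewrite scaler0 [LHS](tlift0 bal) (tlift0 bal) scaler0.
  rewrite scalerDr [LHS](tliftD bal) IHx (tliftD bal) scalerDr uE; congr (_ + _).
  rewrite [c *: _](ktensor_scaleE c phi z) uE linearZ /= evZ.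
  by have [_ ->] := ev_dlinear (l z).
by exists u => y phi; rewrite u'E uE.
Qed.

End KAdjunction.

(** * Right exactness of the tensor product with DB *)

Section TensorMap.
Variables (k : fieldType) (B : falgType k).
Implicit Types Y : lmodType B.

Definition tmap Y Y' (i : Y -> Y') (t : ktensor Y) : ktensor Y' :=
  tlift (fun (phi : dual B) y => tens phi (i y)) t.

Section Linear.
Variables (Y Y' : lmodType B) (i : {linear Y -> Y'}).

Fact tmap_balanced : balanced (fun (phi : dual B) y => tens phi (i y)).
Proof.
split=> [f g y|f y y'|f b y]; first exact: tensDl.
  by rewrite linearD tensDr.
by rewrite linearZ tens_bal.
Qed.

Lemma tmapE phi y : tmap i (tens phi y) = tens phi (i y).
Proof. exact: tliftE tmap_balanced _ _. Qed.

Lemma tmapD s t : tmap i (s + t) = tmap i s + tmap i t.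
Proof. exact: tliftD tmap_balanced _ _. Qed.

Lemma tmap0 : tmap i 0 = 0.
Proof. exact: tlift0 tmap_balanced. Qed.

Lemma tmap_linear : linear (tmap i).
Proof.
move=> c s t; rewrite tmapD; congr (_ + _).
elim/tensor_ind: s => [|phi y s IHs]; first by rewrite !(scaler0, tmap0).
rewrite scalerDr !tmapD IHs scalerDr; congr (_ + _).
by rewrite [c *: _](ktensor_scaleE c) !tmapE [RHS](ktensor_scaleE c) linearZ.
Qed.

End Linear.

Lemma tensor_0r Y (phi : dual B) : tens phi (0 : Y) = 0.
Proof. by apply: (addrI (tens phi 0)); rewrite -tensDr !addr0. Qed.

Lemma tmap_right_exact Y1 Y2 Y3 (i : {linear Y1 -> Y2}) (p : {linear Y2 -> Y3}) :
  (forall y, exists x, p x = y) -> (forall x, p x = 0 <-> exists m, i m = x) ->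
  (forall t, exists s, tmap p s = t) /\
  (forall t, tmap p t = 0 <-> exists s, tmap i s = t).
Proof.
move=> psurj pi; have /choice[s sE] := psurj.
split.
  elim/tensor_ind => [|phi y t [t' <-]]; first by exists 0; apply: tmap0.
  by exists (tens phi (s y) + t'); rewrite tmapD tmapE sE.
have pi0 m : p (i m) = 0 by apply/pi; exists m.
move=> t; split=> [pt0|[t' <-]]; last first.
  elim/tensor_ind: t' => [|phi y t' IH]; first by rewrite !tmap0.
  by rewrite !tmapD IH addr0 !tmapE pi0 tensor_0r.
(* Exactness in the middle: lifting along [p] gives a well-defined balanced map to the cokernel of
   [tmap i], through which the projection [q] factors. *)
have [ti tiE] := linear_fun (tmap_linear i).
have [q [qsurj qE]] := cokernel_proj ti.
have qeq phi y y' : p y = p y' -> q (tens phi y) = q (tens phi y').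
  move=> pyy'; have [m mE] : exists m, i m = y - y'.
    by apply/pi; rewrite linearB pyy' subrr.
  rewrite -[y](subrK y') -mE tensDr [LHS]linearD /= -[RHS]add0r; congr (_ + _).
  by apply/qE; exists (tens phi m); rewrite tiE tmapE.
pose f (phi : dual B) y := q (tens phi (s y)).
have fbal : balanced f.
  split=> [phi psi y|phi y y'|phi b y].
  - by rewrite /f -linearD; congr (q _); apply: tensDl.
  - rewrite /f -linearD -[_ + _ in RHS]tensDr.
    by apply: qeq; rewrite linearD !sE.
  - by rewrite /f tens_bal; apply: qeq; rewrite linearZ !sE.
have ftE t' : tlift f (tmap p t') = q t'.
  elim/tensor_ind: t' => [|phi y t' IH]; first by rewrite tmap0 (tlift0 fbal) linear0.
  rewrite tmapD (tliftD fbal) IH tmapE (tliftE fbal) [RHS]linearD; congr (_ + _).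
  by apply: qeq; rewrite sE.
have /qE[t' <-] : q t = 0 by rewrite -ftE pt0 (tlift0 fbal).
by exists t'; rewrite tiE.
Qed.

End TensorMap.

(** * Coinduction from A to the tensor algebra *)

Section TensorAlgebraModules.
Variables (k : fieldType) (A : algType k) (B : falgType k).
Local Notation AB := (tensor_alg A B).
Implicit Types X Y : lmodType AB.

Lemma tensor_alg_linear X Y (f : X -> Y) :
  (forall x y, f (x + y) = f x + f y) ->
  (forall a x, f (tensor_inl B a *: x) = tensor_inl B a *: f x) ->
  (forall b x, f (tensor_inr A b *: x) = tensor_inr A b *: f x) ->
  linear f.
Proof.
move=> fD fl fr.
have f0 : f 0 = 0 by apply: (addrI (f 0)); rewrite -fD !addr0.
move=> t x y; rewrite fD; congr (_ + _).
elim/tensor_alg_ind: t => [|a b t IH]; first by rewrite !scale0r.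
by rewrite !scalerDl fD IH -tensor_inlr -!scalerA fl fr.
Qed.

Lemma tensor_inl_alg (c : k) : tensor_inl B (c%:A : A) = tensor_inr A (c%:A : B).
Proof. exact: ptensZ. Qed.

Lemma restrict_l_linear X Y (f : {linear X -> Y}) :
  exists g : {linear restrict_l X -> restrict_l Y}, forall x, g x = f x.
Proof.
by apply: linear_fun => a x y; apply: (linearP f (tensor_inl B a) x y).
Qed.

Lemma restrict_r_linear X Y (f : {linear X -> Y}) :
  exists g : {linear restrict_r X -> restrict_r Y}, forall x, g x = f x.
Proof.
by apply: linear_fun => b x y; apply: (linearP f (tensor_inr A b) x y).
Qed.

Lemma restrict_r_exact X1 X2 X3 (i : {linear X1 -> X2}) (p : {linear X2 -> X3}) :
  short_exact i p ->
  exists (i' : {linear restrict_r X1 -> restrict_r X2})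
         (p' : {linear restrict_r X2 -> restrict_r X3}),
    [/\ forall x, i' x = i x, forall x, p' x = p x & short_exact i' p'].
Proof.
move=> [iinj psurj pi].
have [i' i'E] := restrict_r_linear i; have [p' p'E] := restrict_r_linear p.
exists i', p'; split=> //; split.
- by move=> x y; rewrite !i'E => /iinj.
- by move=> y; have [x xE] := psurj y; exists x; rewrite p'E.
move=> x; rewrite p'E; split=> [/pi[m mE]|[m mE]].
  by exists m; rewrite i'E.
by apply/pi; exists m; rewrite -i'E.
Qed.

Lemma dual_tensor_map X Y (f : {linear X -> Y}) :
  exists h : {linear dual_tensor X -> dual_tensor Y}, forall t,
    h t = tmap (f : restrict_r X -> restrict_r Y) t.
Proof.
have [g gE] := restrict_r_linear f.
have fg : (f : restrict_r X -> restrict_r Y) = g by apply: funext => x; rewrite gE.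
apply: linear_fun; rewrite fg => a s t; rewrite [LHS]tmapD; congr (_ + _).
elim/tensor_ind: s => [|phi y s IHs]; first by rewrite !(scaler0, tmap0).
rewrite scalerDr [LHS]tmapD IHs tmapD scalerDr; congr (_ + _).
rewrite [a *: _](dual_tensor_scaleE a phi y) !tmapE.
rewrite [RHS](dual_tensor_scaleE a); congr tens.
by rewrite !gE; apply: (linearZ_LR f (tensor_inl B a) y).
Qed.

Section CoinductionA.
Variable Q : lmodType A.
Local Notation Qk := (restriction (GRing.in_alg A) Q).

(** Hom_k(DB, Q), with A acting on values and B through DB; the carrier is that of [coind], whose
    B-action is recovered in [coindA_inr]. *)
Definition coindA : Type := coind B Qk.
HB.instance Definition _ := GRing.Zmodule.on coindA.

Definition evA (v : coindA) (phi : dual B) : Q := ev (v : coind B Qk) phi.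

Definition coindA_act (a : A) (b : B) (v : coindA) : coindA :=
  coev (fun phi => a *: evA v ((b : B^c) *: phi) : Qk).

Lemma evA_inj v w : (forall phi, evA v phi = evA w phi) -> v = w.
Proof. by move=> evw; apply: (@ev_inj k B Qk). Qed.

Lemma evAD v w phi : evA (v + w) phi = evA v phi + evA w phi.
Proof. exact: (@evDl k B Qk v w phi). Qed.

Lemma evA_dlinear (v : coindA) :
  (forall phi psi, evA v (phi + psi) = evA v phi + evA v psi) /\
  (forall c phi, evA v ((c%:A : B^c) *: phi) = (c%:A : A) *: evA v phi).
Proof. exact: (ev_dlinear (v : coind B Qk)). Qed.

Lemma evA_act a b v phi : evA (coindA_act a b v) phi = a *: evA v ((b : B^c) *: phi).
Proof.
have [evD evZ] := evA_dlinear v.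
apply: (coevK (g := fun phi => a *: evA v ((b : B^c) *: phi) : Qk)).
split=> [psi1 psi2|c psi]; first by rewrite scalerDr evD [LHS]scalerDr.
have swap (x : Q) : a *: ((c%:A : A) *: x) = (c%:A : A) *: (a *: x).
  by rewrite !scalerA -scalerAr -scalerAl mulr1 mul1r.
by rewrite dual_scale_alg evZ; apply: swap.
Qed.

Definition coindA_scale (t : AB) (v : coindA) : coindA :=
  tlift (fun (a : right_mod A) b => coindA_act a b v) t.

Fact coindA_act_balanced v :
  balanced (fun (a : right_mod A) b => coindA_act a b v).
Proof.
have [evD evZ] := evA_dlinear v.
split=> [a a' b|a b b'|a c b]; apply: evA_inj => phi.
- by rewrite evAD !evA_act scalerDl.
- by rewrite evAD !evA_act scalerDl evD scalerDr.
rewrite !evA_act.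
have -> : ((c *: b : B) : B^c) *: phi = (c%:A : B^c) *: ((b : B^c) *: phi).
  by apply: dapp_inj => x; rewrite dapp_alg !dapp_scale -scalerAl dappZr.
by rewrite evZ scalerA -scalerAr mulr1.
Qed.

Lemma coindA_scaleE a b v : coindA_scale (ptens a b) v = coindA_act a b v.
Proof. exact: (tliftE (coindA_act_balanced v)). Qed.

Fact coindA_scaleDl v : {morph coindA_scale^~ v : s t / s + t}.
Proof. by move=> s t; apply/tliftD/coindA_act_balanced. Qed.
Fact coindA_scale0l v : coindA_scale 0 v = 0.
Proof. exact/tlift0/coindA_act_balanced. Qed.
Fact coindA_scaleDr : right_distributive coindA_scale +%R.
Proof.
move=> t v w; elim/tensor_alg_ind: t => [|a b t IH].
  by rewrite !coindA_scale0l addr0.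
rewrite !coindA_scaleDl IH addrACA; congr (_ + _).
by apply: evA_inj => phi; rewrite !coindA_scaleE evAD !evA_act evAD scalerDr.
Qed.
Fact coindA_scale0r t : coindA_scale t 0 = 0.
Proof. by apply: (addrI (coindA_scale t 0)); rewrite -coindA_scaleDr !addr0. Qed.
Fact coindA_scaleA s t v :
  coindA_scale s (coindA_scale t v) = coindA_scale (s * t) v.
Proof.
elim/tensor_alg_ind: s => [|a b s IH]; first by rewrite mul0r !coindA_scale0l.
rewrite mulrDl !coindA_scaleDl {}IH; congr (_ + _).
elim/tensor_alg_ind: t => [|a' b' t IH].
  by rewrite mulr0 !coindA_scale0l coindA_scale0r.
rewrite mulrDr !coindA_scaleDl coindA_scaleDr {}IH; congr (_ + _).
rewrite ptensM !coindA_scaleE; apply: evA_inj => phi.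
by rewrite !evA_act !scalerA.
Qed.
Fact coindA_scale1 : left_id 1 coindA_scale.
Proof.
move=> v; rewrite [LHS](coindA_scaleE 1 1); apply: evA_inj => phi.
by rewrite evA_act !scale1r.
Qed.

HB.instance Definition _ := GRing.Zmodule_isLmodule.Build AB coindA
  coindA_scaleA coindA_scale1 coindA_scaleDr coindA_scaleDl.

Lemma evA_scale a b (v : coindA) phi :
  evA (ptens a b *: v) phi = a *: evA v ((b : B^c) *: phi).
Proof. by rewrite -evA_act -coindA_scaleE. Qed.

Lemma evA_inl a (v : coindA) phi : evA (tensor_inl B a *: v) phi = a *: evA v phi.
Proof. by rewrite [LHS]evA_scale scale1r. Qed.

Lemma evA_inr b (v : coindA) phi :
  evA (tensor_inr A b *: v) phi = evA v ((b : B^c) *: phi).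
Proof. by rewrite [LHS]evA_scale scale1r. Qed.

Lemma coindA_inr b (v : coindA) :
  tensor_inr A b *: v = (b *: (v : coind B Qk) : coindA).
Proof. by apply: evA_inj => phi; rewrite evA_inr; exact: (esym (@evZ k B Qk b v phi)). Qed.

End CoinductionA.
End TensorAlgebraModules.

(** * The two adjunctions of Hom_k(DB, -) and projectivity *)

Section CoindA.
Variables (k : fieldType) (A : algType k) (B : falgType k).
Local Notation AB := (tensor_alg A B).
Implicit Types (X Y : lmodType AB) (Q : lmodType A).
Local Notation scalk Q := (restriction (GRing.in_alg A) Q).

Definition coindA_gen Q (q : Q) : coindA B Q := coind_gen B (q : scalk Q).

Lemma coindA_ind Q (C : coindA B Q -> Prop) :
  C 0 -> (forall v w, C v -> C w -> C (v + w)) ->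
  (forall b q, C (tensor_inr A b *: coindA_gen q)) -> forall v, C v.
Proof.
move=> C0 CD Cgen; apply: (@coind_ind k B (scalk Q) C C0 CD) => b q.
by have := Cgen b q; rewrite coindA_inr.
Qed.

Lemma coindA_inl_gen Q a (q : Q) :
  tensor_inl B a *: coindA_gen q = coindA_gen (a *: q).
Proof.
apply: evA_inj => phi; rewrite evA_inl /evA /coindA_gen !ev_coind_gen.
rewrite [LHS](scalerA a (_%:A)) [RHS](scalerA (_%:A) a).
by rewrite -scalerAr -scalerAl mulr1 mul1r.
Qed.

Lemma tensor_inlC a b : tensor_inl B a * tensor_inr A b = tensor_inr A b * tensor_inl B a.
Proof. by rewrite tensor_inlr tensor_inrl. Qed.

Lemma coindA_lift Q X (theta : {linear Q -> restrict_l X}) :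
  exists h : {linear coindA B Q -> X}, forall q, h (coindA_gen q) = theta q.
Proof.
(* The lift is B-linear by construction; A-linearity is then checked on generators, since the two
   actions commute. *)
have [||h hE] := @coind_lift k B (scalk Q) (restrict_r X) theta.
- by move=> x y; apply: linearD.
- move=> c q; rewrite [LHS](linearZ_LR theta (c%:A)).
  rewrite [LHS](_ : _ = tensor_inl B (c%:A : A) *: (theta q : X)) //.
  by rewrite tensor_inl_alg.
have hr b (v : coindA B Q) : h (tensor_inr A b *: v) = tensor_inr A b *: (h v : X).
  by rewrite coindA_inr [LHS](linearZ_LR h b v).
have [|h' h'E] := @linear_fun AB (coindA B Q) X h.
  apply: tensor_alg_linear => // [x y|a x]; first exact: (linearD h).
  elim/coindA_ind: x => [|v w IHv IHw|b q].
  - by rewrite scaler0 (linear0 h) scaler0.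
  - rewrite scalerDr [LHS](linearD h) IHv IHw (linearD h v w).
    by exact: (esym (@scalerDr _ X _ _ _)).
  rewrite scalerA tensor_inlC -scalerA coindA_inl_gen !hr hE hE.
  rewrite [theta _](linearZ_LR theta a q).
  by rewrite [LHS]scalerA [RHS]scalerA tensor_inlC.
by exists h' => q; rewrite h'E hE.
Qed.

Lemma linear_restrict_l Q X (h : {linear coindA B Q -> X}) :
  exists f : {linear Q -> restrict_l X}, forall q, f q = h (coindA_gen q).
Proof.
apply: linear_fun => a q q'.
rewrite [coindA_gen _](@coind_genD k B (scalk Q)) [LHS](linearD h); congr (_ + _).
by rewrite -[RHS](linearZ_LR h (tensor_inl B a)) coindA_inl_gen.
Qed.

Lemma coindA_projective Q : projective Q -> projective (coindA B Q).
Proof.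
move=> Qproj M N g gsurj f.
have [f' f'E] := linear_restrict_l f; have [g' g'E] := restrict_l_linear g.
have [|theta thetaE] := Qproj _ _ g' _ f'.
  by move=> y; have [x <-] := gsurj y; exists x; rewrite g'E.
have [h hE] := coindA_lift theta; exists h.
elim/coindA_ind => [|v w IHv IHw|b q]; first by rewrite !linear0.
  by rewrite !linearD IHv IHw.
rewrite !linearZ /= hE; congr (_ *: _).
by have := thetaE q; rewrite g'E f'E.
Qed.

Lemma projective_coindA_retract X : projective X ->
  exists (s : {linear X -> coindA B (restrict_l X)})
         (r : {linear coindA B (restrict_l X) -> X}), cancel s r.
Proof.
move=> Xproj.
have [r rE] := coindA_lift (idfun : {linear restrict_l X -> restrict_l X}).
have [|s sE] := Xproj _ _ r _ (idfun : {linear X -> X}); last by exists s, r.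
by move=> y; exists (coindA_gen (y : restrict_l X)); rewrite rE.
Qed.

(** X is a retract of [coindA B (restrict_l X)], which over B is induced from [k]. *)
Lemma restrict_r_projective X : projective X -> projective (restrict_r X).
Proof.
move=> /projective_coindA_retract[s [r sK]].
pose V : lmodType k := scalk (restrict_l X).
have [|s' s'E] := @linear_fun B (restrict_r X) (coind B V) s.
  move=> b x y; rewrite [LHS](linearP s (tensor_inr A b) x y).
  by congr (_ + _); apply: coindA_inr.
have [|r' r'E] := @linear_fun B (coind B V) (restrict_r X) r.
  move=> b v w; rewrite [LHS](linearD r); congr (_ + _).
  by rewrite -coindA_inr; apply: (linearZ_LR r (tensor_inr A b)).
apply: (@projective_retract B (coind B V) (restrict_r X) s' r').
  by move=> x; rewrite r'E s'E.
exact: coind_projective.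
Qed.

Lemma coindA_map Q Q' (g : {linear Q -> Q'}) :
  exists h : {linear coindA B Q -> coindA B Q'},
    forall v phi, evA (h v) phi = g (evA v phi).
Proof.
pose h (v : coindA B Q) : coindA B Q' := coev (fun phi => g (evA v phi) : scalk Q').
have hE v phi : evA (h v) phi = g (evA v phi).
  have [evD evZ] := evA_dlinear v.
  apply: (coevK (g := fun phi => g (evA v phi) : scalk Q')).
  split=> [psi1 psi2|c psi]; first by rewrite evD linearD.
  by rewrite evZ linearZ.
have [|h' h'E] := @linear_fun _ (coindA B Q) (coindA B Q') h.
  apply: tensor_alg_linear => [v w|a v|b v]; apply: evA_inj => phi.
  - by rewrite evAD !hE evAD linearD.
  - by rewrite evA_inl !hE evA_inl linearZ.
  - by rewrite evA_inr !hE evA_inr.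
by exists h' => v phi; rewrite h'E.
Qed.

Lemma coindA_map_surj Q Q' (g : {linear Q -> Q'}) (h : {linear coindA B Q -> coindA B Q'}) :
  (forall y, exists x, g x = y) ->
  (forall v phi, evA (h v) phi = g (evA v phi)) -> forall w, exists v, h v = w.
Proof.
move=> /choice[s sE] hE w.
pose v : coindA B Q :=
  [ffun i => s ((w : {ffun 'I_(\dim {:B}) -> Q'}) i) : scalk Q].
exists v; apply: evA_inj => phi; rewrite hE.
rewrite /evA /ev [LHS](linear_sum g); apply: eq_bigr => i _.
by rewrite [LHS](linearZ_LR g) ffunE sE.
Qed.

Section Adjunction.
Variables (X : lmodType AB) (Q : lmodType A).

Lemma dual_tensor_adj (u : {linear dual_tensor X -> Q}) :
  exists l : {linear X -> coindA B Q}, forall x phi,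
    evA (l x) phi = u (tens phi (x : restrict_r X)).
Proof.
have tensZ c (phi : dual B) (x : restrict_r X) :
    tens ((c%:A : B^c) *: phi) x = (c%:A : A) *: (tens phi x : dual_tensor X).
  rewrite [RHS]dual_tensor_scaleE tens_bal; congr tens.
  by rewrite tensor_inl_alg.
pose l (x : X) : coindA B Q := coev (fun phi => u (tens phi (x : restrict_r X)) : scalk Q).
have lE x phi : evA (l x) phi = u (tens phi (x : restrict_r X)).
  apply: (coevK (g := fun phi => u (tens phi (x : restrict_r X)) : scalk Q)).
  split=> [f g|c f]; first by rewrite -linearD; congr (u _); apply: tensDl.
  by rewrite tensZ linearZ.
have [|l' l'E] := @linear_fun _ X (coindA B Q) l.
  apply: tensor_alg_linear => [x y|a x|b x]; apply: evA_inj => phi.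
  - by rewrite evAD !lE -linearD; congr (u _); apply: tensDr.
  - by rewrite evA_inl !lE -linearZ; congr (u _); rewrite [RHS]dual_tensor_scaleE.
  - by rewrite evA_inr !lE tens_bal.
by exists l' => x phi; rewrite l'E.
Qed.

Lemma dual_tensor_coadj (l : {linear X -> coindA B Q}) :
  exists u : {linear dual_tensor X -> Q}, forall x phi,
    u (tens phi (x : restrict_r X)) = evA (l x) phi.
Proof.
pose f (phi : dual B) (x : restrict_r X) := evA (l x) phi.
have bal : balanced f.
  rewrite /f; split=> [phi psi x|phi x y|phi b x].
  - by have [evD _] := evA_dlinear (l x); rewrite evD.
  - by rewrite [l _](linearD l) evAD.
  - by rewrite [l (b *: x)](linearZ_LR l (tensor_inr A b)) evA_inr.
have uE phi (x : restrict_r X) : tlift f (tens phi x) = evA (l x) phi by exact: tliftE.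
have [|u u'E] := @linear_fun A (dual_tensor X) Q (tlift f).
  move=> a x y; rewrite [LHS](tliftD bal); congr (_ + _).
  elim/tensor_ind: x => [|phi z x IHx].
    by rewrite scaler0 [LHS](tlift0 bal) (tlift0 bal) scaler0.
  rewrite scalerDr [LHS](tliftD bal) IHx (tliftD bal) scalerDr uE; congr (_ + _).
  by rewrite [a *: _](dual_tensor_scaleE a phi z) uE linearZ /= evA_inl.
by exists u => x phi; rewrite u'E uE.
Qed.

End Adjunction.

Lemma dual_tensor_projective X : projective X -> projective (dual_tensor X).
Proof.
move=> Xproj M N g gsurj f.
have [l lE] := dual_tensor_adj f; have [h hE] := coindA_map g.
have [l' l'E] := Xproj _ _ h (coindA_map_surj gsurj hE) l.
have [u uE] := dual_tensor_coadj l'; exists u.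
elim/tensor_ind => [|phi x t IH]; first by rewrite !linear0.
rewrite [u _](linearD u) [g _](linearD g) IH [RHS](linearD f); congr (_ + _).
by rewrite /= uE -hE l'E lE.
Qed.

(** Any map from X to some G Q factors through the unit X -> GFX. Applied to a split embedding into
    G Q, this splits the unit. *)
Lemma projective_coindA_dual_tensor X : projective X ->
  exists (s : {linear X -> coindA B (dual_tensor X)})
         (r : {linear coindA B (dual_tensor X) -> X}), cancel s r.
Proof.
move=> /projective_coindA_retract[s [r sK]].
have [eta etaE] := dual_tensor_adj (idfun : {linear dual_tensor X -> dual_tensor X}).
have [u uE] := dual_tensor_coadj s; have [h hE] := coindA_map u.
exists eta, (r \o h) => x /=; rewrite (_ : h _ = s x) ?sK //.
by apply: evA_inj => phi; rewrite hE etaE uE.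
Qed.

End CoindA.

(** * Extension of maps to projective modules *)

Section ExtensionB.
Variables (k : fieldType) (B : falgType k).
Implicit Types Y K P : lmodType B.

Lemma ktensor_eq Y (V : zmodType) (f g : ktensor Y -> V) :
  (forall s t, f (s + t) = f s + f t) -> (forall s t, g (s + t) = g s + g t) ->
  (forall phi y, f (tens phi y) = g (tens phi y)) -> f =1 g.
Proof.
move=> fD gD fg.
have f0 : f 0 = 0 by apply: (addrI (f 0)); rewrite -fD !addr0.
have g0 : g 0 = 0 by apply: (addrI (g 0)); rewrite -gD !addr0.
by elim/tensor_ind => [|phi y t IH]; rewrite ?f0 ?g0 // fD gD fg IH.
Qed.

(** Projectives are retracts of modules [coind B V], and maps into these are functionals on DB (x) Y
    with values in the injective V. *)
Lemma tmap_inj_extends Y Y' (i : {linear Y -> Y'}) :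
  injective (tmap i) -> proj_extends i.
Proof.
move=> ti_inj Q /projective_coind_retract[V [s [r sK]]] f.
have [u uE] := ktensor_coadj (s \o f); have [ti tiE] := linear_fun (tmap_linear i).
have [|w wE] := @vect_injective k V _ _ ti _ u.
  by move=> x y; rewrite !tiE => /ti_inj.
have [l lE] := ktensor_adj w; exists (r \o l) => y /=.
rewrite (_ : l (i y) = s (f y)) ?sK //; apply: ev_inj => phi.
by rewrite lE -uE -wE tiE tmapE.
Qed.

(** Extending the unit of the adjunction along [i] and transposing gives a left inverse of
    [tmap i]. *)
Lemma extends_tmap_inj K P (i : {linear K -> P}) :
  proj_extends i -> injective (tmap i).
Proof.
move=> iext.
have [l lE] := ktensor_adj (idfun : {linear ktensor K -> ktensor K}).
have [l' l'E] := iext _ (@coind_projective k B _) l.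
have [u uE] := ktensor_coadj l'.
apply: (can_inj (g := u)).
apply: ktensor_eq => [s t|s t|phi y] //; first by rewrite tmapD linearD.
by rewrite tmapE uE l'E lE.
Qed.

(** Biduality of the finite-dimensional space B: [b] goes to evaluation at [b]. *)
Lemma coind_regular : isomorphic (coind B (k^o : lmodType k)) (B^o : lmodType B).
Proof.
apply: iso_sym.
pose h (b : B) : coind B k^o := coev (fun phi => dapp phi b : k^o).
have hE b phi : ev (h b) phi = dapp phi b.
  apply: (coevK (g := fun phi => dapp phi b : k^o)).
  by split=> [f g|c f]; rewrite ?dappDl ?dapp_alg.
have [|g gE] := @linear_fun B (B^o : lmodType B) (coind B k^o) h.
  move=> a x y; apply: ev_inj => phi; rewrite evDl evZ !hE dapp_scale.
  exact: dappDr.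
exists g; split=> [x y|v].
  rewrite !gE => hxy; rewrite [x]basis_expand [y]basis_expand.
  by apply: eq_bigr => i _; rewrite -!dual_basisE -!hE hxy.
exists (\sum_(i < \dim {:B}) (v : {ffun _ -> k^o}) i *: (vbasis {:B})`_i).
apply: ev_inj => phi; rewrite gE hE /dapp [LHS](linear_sum (phi : 'Hom(B, k^o))).
by apply: eq_bigr => i _; rewrite [LHS]dappZr mulrC.
Qed.

Lemma regular_extends_tmap_inj K P (i : {linear K -> P}) :
  (forall f : {linear K -> (B^o : lmodType B)},
     exists g : {linear P -> (B^o : lmodType B)}, forall x, g (i x) = f x) ->
  injective (tmap i).
Proof.
move=> iext; have [ti tiE] := linear_fun (tmap_linear i).
move=> x y; rewrite -!tiE; move: x y; apply: raddf_inj => t ti0.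
apply/eqP/contraT => t_neq0.
(* A functional [u] with value 1 at [t] transposes to a map K -> B. Its extension to P transposes
   back to [w] with w (tmap i s) = u s, which is absurd at s = t. *)
have [|c cE] := @linear_fun k (k^o : lmodType k) (ktensor K) (fun c => (c : k) *: (t : ktensor K)).
  by move=> a x y; rewrite scalerDl scalerA.
have [|u uE] := @vect_injective k (k^o : lmodType k) _ _ c _ (idfun : {linear k^o -> k^o}).
  move=> x y; rewrite !cE => /eqP; rewrite -subr_eq0 -scalerBl scaler_eq0.
  by rewrite (negPf t_neq0) orbF subr_eq0 => /eqP.
have [l lE] := ktensor_adj u.
have [a [a_inj a_surj]] := coind_regular.
have [b bE] := @factor_inj _ _ _ _ a (idfun : {linear B^o -> B^o}) a_inj a_surj.
have [g gE] := iext (a \o l).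
have [w wE] := ktensor_coadj (b \o g).
have wti s : w (tmap i s) = u s.
  apply: (@ktensor_eq K k^o (w \o tmap i) u) => [x y|x y|phi y] /=.
  - by rewrite tmapD linearD.
  - by rewrite linearD.
  rewrite tmapE wE -lE; congr (ev _ phi) => /=.
  by rewrite gE; apply: a_inj; rewrite bE.
have := uE 1; rewrite cE scale1r -wti -tiE ti0 linear0 => /eqP.
by rewrite eq_sym oner_eq0.
Qed.

End ExtensionB.

Section ExtensionAB.
Variables (k : fieldType) (A : algType k) (B : falgType k).
Local Notation AB := (tensor_alg A B).
Implicit Types X Y : lmodType AB.

(** Embed Q as a retract of GFQ, transpose to a map FX -> FQ with FQ projective, extend it, and
    transpose back. *)
Lemma dual_tensor_extends X Y (i : {linear X -> Y})
    (h : {linear dual_tensor X -> dual_tensor Y}) :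
  (forall t, h t = tmap (i : restrict_r X -> restrict_r Y) t) ->
  proj_extends h -> proj_extends i.
Proof.
move=> hE hext Q Qproj f; have [s [r sK]] := projective_coindA_dual_tensor Qproj.
have [i' i'E] := restrict_r_linear i.
have ii' : (i : restrict_r X -> restrict_r Y) = i' by apply: funext => x; rewrite i'E.
have [u uE] := dual_tensor_coadj (s \o f).
have [w wE] := hext _ (dual_tensor_projective Qproj) u.
have [l lE] := dual_tensor_adj w; exists (r \o l) => x /=.
rewrite (_ : l (i x) = s (f x)) ?sK //; apply: evA_inj => phi.
by rewrite lE -uE -wE hE ii' tmapE i'E.
Qed.

Lemma extends_dual_tensor X Y (i : {linear X -> Y})
    (h : {linear dual_tensor X -> dual_tensor Y}) :
  (forall t, h t = tmap (i : restrict_r X -> restrict_r Y) t) ->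
  proj_extends i -> proj_extends h.
Proof.
move=> hE iext Q Qproj f.
have [i' i'E] := restrict_r_linear i.
have ii' : (i : restrict_r X -> restrict_r Y) = i' by apply: funext => x; rewrite i'E.
have [l lE] := dual_tensor_adj f.
have [l' l'E] := iext _ (coindA_projective Qproj) l.
have [u uE] := dual_tensor_coadj l'; exists u.
apply: (@ktensor_eq k B (restrict_r X) Q (u \o h) f) => [s t|s t|phi x] /=.
- by rewrite (linearD h) (linearD u).
- exact: (linearD f).
- by rewrite hE ii' tmapE i'E uE l'E lE.
Qed.

Lemma dual_tensor_exact X1 X2 X3 (i : {linear X1 -> X2}) (p : {linear X2 -> X3}) :
  short_exact i p -> injective (tmap (i : restrict_r X1 -> restrict_r X2)) ->
  exists (Fi : {linear dual_tensor X1 -> dual_tensor X2})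
         (Fp : {linear dual_tensor X2 -> dual_tensor X3}),
    (forall t, Fi t = tmap (i : restrict_r X1 -> restrict_r X2) t) /\
    short_exact Fi Fp.
Proof.
move=> ip ti_inj; have [i' [p' [i'E p'E [_ p'surj p'i']]]] := restrict_r_exact ip.
have ii' : (i : restrict_r X1 -> restrict_r X2) = i' by apply: funext => x; rewrite i'E.
have pp' : (p : restrict_r X2 -> restrict_r X3) = p' by apply: funext => x; rewrite p'E.
have [Fi FiE] := dual_tensor_map i; have [Fp FpE] := dual_tensor_map p.
have [tsurj tex] := tmap_right_exact p'surj p'i'.
exists Fi, Fp; split=> //; split.
- by move=> s t; rewrite !FiE => /ti_inj.
- by move=> t; have [s sE] := tsurj t; exists s; rewrite FpE pp'.
move=> t; rewrite FpE pp'; split=> [/tex[s sE]|[s sE]].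
  by exists s; rewrite FiE ii'.
by apply/tex; exists s; rewrite -ii' -FiE.
Qed.

End ExtensionAB.

(** * Dimension shifting against a module of finite injective dimension *)

Section InjectiveDimension.
Variables (R : pzRingType) (W : lmodType R) (K : int -> lmodType R).
Hypothesis Kres : forall i, exists (P : lmodType R) (j : {linear K i -> P})
  (p : {linear P -> K (i + 1)}), projective P /\ short_exact j p.

Lemma finite_injdim_extends : finite_injdim W ->
  forall i (P : lmodType R) (j : {linear K i -> P}) (p : {linear P -> K (i + 1)}),
  projective P -> short_exact j p ->
  forall f : {linear K i -> W}, exists g : {linear P -> W}, forall x, g (j x) = f x.
Proof.
move=> [n [I [d [e [Iinj einj d0e dd I0]]]]] i0 P0 j0 p0 P0proj jp0 f0.
have dK i x : d i.+1 (d i x) = 0 by apply/dd; exists x.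
(* Extension of maps into the cocycles of [I s], by induction on the distance [m] to the vanishing
   range of the resolution; each step moves one place to the right in both [I] and [K]. *)
have ext m s : (n < m + s)%N ->
    forall i (P : lmodType R) (j : {linear K i -> P}) (p : {linear P -> K (i + 1)}),
    projective P -> short_exact j p ->
    forall f : {linear K i -> I s}, (forall x, d s (f x) = 0) ->
    exists g : {linear P -> I s},
      (forall x, d s (g x) = 0) /\ forall x, g (j x) = f x.
  elim: m s => [|m IHm] s nms i P j p Pproj jp f df0.
    have [|z zE] := @linear_fun R P (I s) (fun=> 0).
      by move=> a x y; rewrite scaler0 addr0.
    exists z; split=> x; rewrite zE ?linear0 //.
    by rewrite (I0 _ nms (f x)).
  have [jinj psurj pj] := jp.
  have [g gE] := Iinj s _ _ j jinj f.
  have [x /pj[y <-]|q qE] := factor_surj (f := d s \o g) psurj.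
    by rewrite /= gE.
  have [P' [j' [p' [P'proj jp']]]] := Kres (i + 1).
  have [||h [dh hE]] := IHm s.+1 _ (i + 1) P' j' p' P'proj jp' q.
  - by rewrite addnS -addSn.
  - by move=> y; have [x <-] := psurj y; rewrite qE /= dK.
  have [inc [inc_inj incE]] := kernel_incl (d s.+1).
  have [x|h1 h1E] := @factor_inj _ _ _ _ inc h inc_inj.
    exact/incE.
  have [x|d1 d1E] := @factor_inj _ _ _ _ inc (d s) inc_inj.
    exact/incE.
  have [|h' h'E] := P'proj _ _ d1 _ h1.
    move=> y; have /dd[x xE] : d s.+1 (inc y) = 0 by apply/incE; exists y.
    by exists x; apply: inc_inj; rewrite d1E.
  (* The extension [g] into [I s] need not land in cocycles. Its coboundary extends to [P'] and
     lifts to [h']; the correction through [p] removes it without changing values on [K i]. *)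
  have [g' g'E] := linear_sub g (h' \o j' \o p).
  exists g'; split=> x; rewrite g'E /=.
    rewrite linearB -[d s (h' _)]d1E h'E h1E hE qE /=.
    exact: subrr.
  have pj0 : p (j x) = 0 by apply/pj; exists x.
  by rewrite gE pj0 !linear0 addr0.
have [||g [dg gE]] := ext n.+1 0%N _ i0 P0 j0 p0 P0proj jp0 (e \o f0).
- by rewrite addn0.
- by move=> x; apply/d0e; exists (f0 x).
have [x|g' g'E] := @factor_inj _ _ _ _ e g einj.
  exact/d0e.
by exists g' => x; apply: einj; rewrite g'E gE.
Qed.

End InjectiveDimension.

(** * The two implications *)

Section Implications.
Variables (k : fieldType) (A : algType k) (B : falgType k).
Local Notation AB := (tensor_alg A B).
Implicit Types X Y : lmodType AB.

Lemma restrict_r_iso X Y : isomorphic X Y -> isomorphic (restrict_r X) (restrict_r Y).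
Proof.
move=> [f [finj fsurj]]; have [g gE] := restrict_r_linear f.
exists g; split=> [x y|y]; first by rewrite !gE => /finj.
by have [x xE] := fsurj y; exists x; rewrite gE.
Qed.

Lemma dual_tensor_iso X Y :
  isomorphic X Y -> isomorphic (dual_tensor X) (dual_tensor Y).
Proof.
move=> [f [finj fsurj]].
have [g gE] := @factor_inj _ _ _ _ f (idfun : {linear Y -> Y}) finj fsurj.
have [f' f'E] := restrict_r_linear f; have [g' g'E] := restrict_r_linear g.
have ff' : (f : restrict_r X -> restrict_r Y) = f' by apply: funext => x; rewrite f'E.
have gg' : (g : restrict_r Y -> restrict_r X) = g' by apply: funext => x; rewrite g'E.
have [Ff FfE] := dual_tensor_map f; have [Fg FgE] := dual_tensor_map g.
apply: (@iso_cancel _ _ _ Ff Fg).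
  apply: (@ktensor_eq k B (restrict_r X) (dual_tensor X) (Fg \o Ff) idfun) =>
    [s t|s t|phi x] //=; first by rewrite (linearD Ff) (linearD Fg).
  rewrite FfE FgE ff' gg' !tmapE f'E g'E; congr tens.
  by apply: finj; rewrite gE.
apply: (@ktensor_eq k B (restrict_r Y) (dual_tensor Y) (Ff \o Fg) idfun) =>
  [s t|s t|phi y] //=; first by rewrite (linearD Fg) (linearD Ff).
by rewrite FgE FfE ff' gg' !tmapE f'E g'E gE.
Qed.

(** Finite injective dimension of B extends maps to B along every embedding of the complex; by
    [regular_extends_tmap_inj] these stay injective after tensoring with DB. *)
Lemma gp_dual_tensor_restrict X : finite_injdim (B^o : lmodType B) ->
  gorenstein_projective X ->
  gorenstein_projective (dual_tensor X) /\ gorenstein_projective (restrict_r X).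
Proof.
move=> Binj /gp_cosyzygies[K [Kco XK]].
have Kres i : exists (P : lmodType B) (j : {linear restrict_r (K i) -> P})
    (p : {linear P -> restrict_r (K (i + 1))}), projective P /\ short_exact j p.
  have [P [j [p [Pproj jp _]]]] := Kco i.
  have [j' [p' [_ _ jp']]] := restrict_r_exact jp.
  by exists (restrict_r P), j', p'; split=> //; apply: restrict_r_projective.
have Binj' := @finite_injdim_extends _ _ (fun i => restrict_r (K i)) Kres Binj.
split.
  apply: gp_iso (dual_tensor_iso XK) _.
  apply: (@gp_of_cosyzygies A (fun i => dual_tensor (K i))) => i.
  have [P [j [p [Pproj jp jext]]]] := Kco i.
  have [j' [p' [j'E _ jp']]] := restrict_r_exact jp.
  have jj' : (j : restrict_r (K i) -> restrict_r P) = j'.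
    by apply: funext => x; rewrite j'E.
  have [|Fj [Fp [FjE Fjp]]] := dual_tensor_exact jp.
    rewrite jj'; apply: regular_extends_tmap_inj.
    exact: Binj' (restrict_r_projective Pproj) jp'.
  exists (dual_tensor P), Fj, Fp; split=> //; first exact: dual_tensor_projective.
  exact: extends_dual_tensor FjE jext.
apply: gp_iso (restrict_r_iso XK) _.
apply: (@gp_of_cosyzygies B (fun i => restrict_r (K i))) => i.
have [P [j [p [Pproj jp _]]]] := Kco i.
have [j' [p' [_ _ jp']]] := restrict_r_exact jp.
exists (restrict_r P), j', p'; split=> //; first exact: restrict_r_projective.
apply/tmap_inj_extends/regular_extends_tmap_inj.
exact: Binj' (restrict_r_projective Pproj) jp'.
Qed.

Definition gp_pair X : Prop :=
  gorenstein_projective (dual_tensor X) /\ gorenstein_projective (restrict_r X).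

(** Cover X by G P0, where P0 is a projective A-module mapping onto X. [gp_kernel] applies to the
    kernel over B and, after F, over A. *)
Lemma gp_pair_prev X : gp_pair X -> exists Y, gp_pair Y /\ cosyzygy Y X.
Proof.
move=> [FXgp Xgp].
have [P0 [p0 [P0proj p0surj]]] := enough_projectives (restrict_l X).
have Pproj := @coindA_projective k A B P0 P0proj.
have [h hE] := coindA_lift p0; have [i [iinj iE]] := kernel_incl h.
have ih : short_exact i h.
  by split=> // x; have [q qE] := p0surj x; exists (coindA_gen B q); rewrite hE.
have [i' [h' [i'E _ ih']]] := restrict_r_exact ih.
have ii' : (i : restrict_r (kernel h) -> restrict_r (coindA B P0)) = i'.
  by apply: funext => x; rewrite i'E.
have [Kgp i'ext] := gp_kernel Xgp (restrict_r_projective Pproj) ih'.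
have [|Fi [Fh [FiE Fih]]] := dual_tensor_exact ih.
  by rewrite ii'; apply: extends_tmap_inj.
have [FKgp Fiext] := gp_kernel FXgp (dual_tensor_projective Pproj) Fih.
exists (kernel h); split=> //; exists (coindA B P0), i, h; split=> //.
exact: dual_tensor_extends FiE Fiext.
Qed.

(** The embedding X -> G Q is the transpose of an approximation FX -> Q. *)
Lemma gp_pair_next X : gp_pair X -> exists Y, gp_pair Y /\ cosyzygy X Y.
Proof.
move=> [FXgp Xgp].
have [C [_ [Q [j [_ [Qproj [jinj _ _] jext]]]]]] := gp_next FXgp.
have Pproj := @coindA_projective k A B Q Qproj.
have [l lE] := dual_tensor_adj j.
have [l' l'E] := restrict_r_linear l.
have ll' : (l : restrict_r X -> restrict_r (coindA B Q)) = l'.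
  by apply: funext => x; rewrite l'E.
(* X embeds over B in a projective, hence in some [coind B V], so its elements are separated by
   their tensors with DB; on these [j] is injective. *)
have linj : injective l.
  have [D [_ [P' [i [_ [P'proj [iinj _ _] _]]]]]] := gp_next Xgp.
  have [V [s [r sK]]] := projective_coind_retract P'proj.
  have [u uE] := ktensor_coadj (s \o i) => x y lxy.
  apply: iinj; apply: (can_inj sK); apply: ev_inj => phi.
  rewrite -[s (i x)]/((s \o i) x) -[s (i y)]/((s \o i) y) -!uE; congr (u _).
  by apply: jinj; rewrite -!lE lxy.
(* [c] is the counit FGQ -> Q. The triangle identity c (F l) = j makes F l injective and hands it
   the extension property of [j]. *)
have [c cE] := dual_tensor_coadj (idfun : {linear coindA B Q -> coindA B Q}).
have clE : c \o tmap l' =1 j.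
  apply: (@ktensor_eq k B (restrict_r X) Q (c \o tmap l') j) => [s t|s t|phi x] /=.
  - by rewrite tmapD (linearD c).
  - exact: (linearD j).
  - by rewrite tmapE l'E cE lE.
have tl_inj : injective (tmap l').
  by move=> s t /(congr1 c); rewrite -![c (tmap _ _)]/((c \o tmap l') _) !clE => /jinj.
have [p [psurj pE]] := cokernel_proj l.
have lp : short_exact l p by [].
have [l2 [p2 [l2E _ lp2]]] := restrict_r_exact lp.
have ll2 : (l' : restrict_r X -> restrict_r (coindA B Q)) = l2.
  by apply: funext => x; rewrite l'E l2E.
have [|Fl [Fp [FlE Flp]]] := dual_tensor_exact lp; first by rewrite ll'.
have Flext : proj_extends Fl.
  move=> W Wproj f; have [g gE] := jext W Wproj f; exists (g \o c) => t /=.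
  by rewrite FlE ll' -[c _]/((c \o tmap l') t) clE gE.
exists (coker l); split; last first.
  by exists (coindA B Q), l, p; split=> //; apply: dual_tensor_extends FlE Flext.
split; first exact: gp_cokernel FXgp (dual_tensor_projective Pproj) Flp Flext.
apply: gp_cokernel Xgp (restrict_r_projective Pproj) lp2 _.
by apply: tmap_inj_extends; rewrite -ll2.
Qed.

End Implications.

Theorem theorem1p1 (k : fieldType) (A : algType k) (B : falgType k)
    (hA : coherent A) (hB : gorenstein_algebra B)
    (X : lmodType (tensor_alg A B)) (hX : finitely_presented X) :
  gorenstein_projective X <->
  (gorenstein_projective (dual_tensor X : lmodType A) /\
   gorenstein_projective (restrict_r X : lmodType B)).
Proof.
split; first exact: gp_dual_tensor_restrict hB.1.
exact: (gp_coind (@gp_pair_next k A B) (@gp_pair_prev k A B)).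
Qed.
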